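(* Let $A,C\in\mathbb R^{m\times n}$ be non-zero matrices and $\beta\in\mathbb R^n$ a non-zero vector such that the polyhedra $P$ and $Q'$ are non-degenerate. Then the set $\mathcal N$ of fully-labeled points admits a decomposition into mutually disjoint connected components $$\mathcal N=\mathcal P\cup\mathcal C_1\cup\dots\cup\mathcal C_k,\qquad k\ge0,$$ where $\mathcal P$ and the $\mathcal C_i$ respectively form a path and cycles on the $1$-skeleton of $P\times Q'$.
   Context: Let $S_1=\{1,\dots,m\}$, $S_2=\{1,\dots,n\}$. For a matrix $M$, $M_i$ is its $i$-th row and $M^j$ its $j$-th column. $P=\{(y,\pi_1)\in\mathbb R^{n+1}: A_iy-\pi_1\le0\ (i\in S_1);\ y_j\ge0\ (j\in S_2);\ \sum_j y_j=1\}$ (of dimension $n$). $Q'=\{(x,\lambda,\pi_2)\in\mathbb R^{m+2}: x_i\ge0\ (i\in S_1);\ x^TC^j+\beta_j\lambda-\pi_2\le0\ (j\in S_2);\ \sum_i x_i=1\}$ (of dimension $m+1$). In both polyhedra the inequalities indexed by $i\in S_1$ are numbered $1,\dots,m$ and those indexed by $j\in S_2$ are numbered $m+1,\dots,m+n$. The label $L(v)$ of a point $v$ is the set of numbers of the inequalities tight at $v$. $\mathcal N=\{(v,w)\in P\times Q': L(v)\cup L(w)=\{1,\dots,m+n\}\}$. Non-degeneracy: every point in the relative interior of a $d$-dimensional face of $P$ (resp. $Q'$) has exactly $n-d$ (resp. $m+1-d$) tight inequalities; in particular $|L(v)|\le n$ on $P$ and $|L(w)|\le m+1$ on $Q'$,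 with equality iff the point is a vertex. Non-degeneracy of $Q'$ is understood to entail that $\beta$ is not constant, i.e. an index of a minimum entry of $\beta$ and an index of a maximum entry of $\beta$ are distinct. A path on the $1$-skeleton is a connected union of vertices and edges ($1$-dimensional faces) of $P\times Q'$ homeomorphic to $\mathbb R$, with an unbounded edge at each of its two ends; a cycle is a connected union of finitely many vertices and bounded edges homeomorphic to a circle.
   Formalization: Non-degeneracy of Q' also requires that the minimum and the maximum entry of β are each attained at a single index; with β merely non-constant the claim fails, e.g. A=[1 0 0; 0 1 1], C=[1 0 0; 0 1 0], β=(1,1,0) gives four unbounded ends. *)

(* Defs.v *)
From HB Require Import structures.
From mathcomp Require Import all_boot all_order all_algebra.
From mathcomp Require Import all_classical all_reals all_analysis.
Import Order.TTheory GRing.Theory Num.Theory.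
Import numFieldNormedType.Exports.

Set Implicit Arguments.
Unset Strict Implicit.
Unset Printing Implicit Defensive.

Local Open Scope classical_set_scope.
Local Open Scope ring_scope.

Section ConvexGeometry.
Variables (R : realType) (V : normedModType R).
Implicit Types K F : set V.

(* The empty set has an empty affine hull: an empty sum is never 1. *)
Definition affine_hull F : set V :=
  [set y | exists k (p : 'I_k -> V) (a : 'I_k -> R),
     [/\ forall i, F (p i), \sum_i a i = 1 & y = \sum_i a i *: p i]].

Definition lin_indep d (v : 'I_d -> V) : Prop :=
  forall c : 'I_d -> R, \sum_i c i *: v i = 0 -> forall i, c i = 0.

(* In particular the empty set has no dimension. *)
Definition has_dim F (d : nat) : Prop :=
  exists (x0 : V) (v : 'I_d -> V), lin_indep v /\
    affine_hull F = [set x0 + \sum_i c i *: v i | c in [set: 'I_d -> R]].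

Definition relint F : set V :=
  [set x | F x /\
     exists2 e : R, 0 < e & forall y, affine_hull F y -> ball x e y -> F y].

(* The zero functional makes K (and the empty set) a face of K. *)
Definition is_face K F : Prop :=
  exists (f : {linear V -> R^o}) (b : R),
    (forall x, K x -> f x <= b) /\ F = K `&` [set x | f x = b].

Definition is_vertex K F : Prop := is_face K F /\ has_dim F 0.

Definition is_edge K F : Prop := is_face K F /\ has_dim F 1.

Definition nondegenerate K (q : nat) (L : V -> {set 'I_q}) (D : nat) : Prop :=
  forall F d v, is_face K F -> has_dim F d -> relint F v -> (#|L v| + d = D)%N.

End ConvexGeometry.

Section Topology.
Variables (T U : topologicalType).

Definition homeomorphism (A : set T) (B : set U) (f : T -> U) (g : U -> T) :=
  [/\ {within A, continuous f}, {within B, continuous g},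
      forall x, A x -> B (f x) /\ g (f x) = x
    & forall y, B y -> A (g y) /\ f (g y) = y].

Definition is_component (A X : set T) : Prop :=
  X !=set0 /\ forall x, X x -> X = connected_component A x.

End Topology.

Section Skeleton.
Variables (R : realType) (V : normedModType R).
Implicit Types K X : set V.

Definition unit_circle : set (R * R)%type :=
  [set p | p.1 ^+ 2 + p.2 ^+ 2 = 1].

Definition is_path K X : Prop :=
  exists (Fs : set (set V)) (f : R -> V) (g : V -> R),
  [/\ forall F, Fs F -> is_vertex K F \/ is_edge K F,
      X = \bigcup_(F in Fs) F, connected X, homeomorphism [set: R] X f g
    & (exists F a, [/\ Fs F, is_edge K F, ~ bounded_set F
         & forall t, t <= a -> F (f t)]) /\
      (exists F a, [/\ Fs F, is_edge K F, ~ bounded_set F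
         & forall t, a <= t -> F (f t)])].

Definition is_cycle K X : Prop :=
  exists (Fs : set (set V)) (f : R * R -> V) (g : V -> R * R),
  [/\ finite_set Fs,
      forall F, Fs F -> is_vertex K F \/ (is_edge K F /\ bounded_set F),
      X = \bigcup_(F in Fs) F, connected X
    & homeomorphism unit_circle X f g].

End Skeleton.

Section Polyhedra.
Variables (R : realType) (m n : nat).

(* (y, pi1) *)
Definition Pspace := ('cV[R]_n * R)%type.
(* ((x, lambda), pi2) *)
Definition Qspace := ('cV[R]_m * R * R)%type.

Variables (A C : 'M[R]_(m, n)) (beta : 'cV[R]_n).

Definition polyhedronP : set Pspace :=
  [set v : Pspace | let: (y, pi1) := v in
    [/\ forall i : 'I_m, (A *m y) i 0 - pi1 <= 0,
        forall j : 'I_n, 0 <= y j 0 & \sum_j y j 0 = 1]].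

Definition polyhedronQ : set Qspace :=
  [set w : Qspace | let: (x, lam, pi2) := w in
    [/\ forall i : 'I_m, 0 <= x i 0,
        forall j : 'I_n, (x^T *m C) 0 j + beta j 0 * lam - pi2 <= 0
      & \sum_i x i 0 = 1]].

(* Labels are numbered from 0: 'I_m first, then 'I_n shifted by m. *)
Definition labelP (v : Pspace) : {set 'I_(m + n)} :=
  let: (y, pi1) := v in
  [set k | match fintype.split k with
           | inl i => (A *m y) i 0 - pi1 == 0
           | inr j => y j 0 == 0
           end]%SET.

Definition labelQ (w : Qspace) : {set 'I_(m + n)} :=
  let: (x, lam, pi2) := w in
  [set k | match fintype.split k with
           | inl i => x i 0 == 0
           | inr j => (x^T *m C) 0 j + beta j 0 * lam - pi2 == 0
           end]%SET.

Definition fully_labeled : set (Pspace * Qspace)%type :=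
  [set vw | [/\ polyhedronP vw.1, polyhedronQ vw.2
            & (labelP vw.1 :|: labelQ vw.2)%SET = [set: 'I_(m + n)]%SET]].

Definition nondegenerateP : Prop := nondegenerate polyhedronP labelP n.

(* beta has one index js of its minimum, one index jl of its maximum, and they
   differ.  Uniqueness is not a consequence of the tightness count, which sees
   no point at infinity: a tie for the minimum or the maximum of beta is a
   degeneracy of the recession cone {(0, l, p) | beta_j l <= p for all j} of
   polyhedronQ, whose two extreme rays must each make a single inequality indexed by
   j tight.  With a tie, fully_labeled may have more than two unbounded ends:
   for A = [1 0 0; 0 1 1], C = [1 0 0; 0 1 0], beta = (1, 1, 0) it has
   three ends with lambda -> +oo and one with lambda -> -oo. *)
Definition distinct_extremal_indices : Prop :=
  exists js jl : 'I_n,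
  [/\ forall j, j != js -> beta js 0 < beta j 0,
      forall j, j != jl -> beta j 0 < beta jl 0 & js != jl].

Definition nondegenerateQ : Prop :=
  nondegenerate polyhedronQ labelQ m.+1 /\ distinct_extremal_indices.

End Polyhedra.

(* Main.v *)
Require Import Defs.
From HB Require Import structures.
From mathcomp Require Import all_boot all_order all_algebra.
From mathcomp Require Import all_classical all_reals all_analysis.
From mathcomp Require Import ring lra zify.
Import Order.TTheory GRing.Theory Num.Theory.
Import numFieldNormedType.Exports.

(* Choosing for every label which of its two inequalities is tight splits the
   fully labeled set into finitely many cells.  By non-degeneracy the gradients
   of the tight inequalities are independent, so a nonempty cell is a
   non-degenerate interval on a line, hence an edge of P x Q'; a point with both
   inequalities of a label tight has only one such label k, is an end of its cell,
   and lies in exactly one other cell, obtained by changing the choice at k.  The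
   cells therefore form a graph in which segments have two neighbours and
   half-lines have one.  A half-line can only escape in the lambda direction,
   where the tight label j maximises beta_j (lambda -> +oo) or minimises it
   (lambda -> -oo); this determines the whole choice, so there are exactly two
   half-lines.  The chain started at one of them must stop at the other, and every
   remaining chain closes up. *)

Set Implicit Arguments.
Unset Strict Implicit.
Unset Printing Implicit Defensive.

Local Open Scope classical_set_scope.
Local Open Scope ring_scope.

(** * Gluing homeomorphisms *)

(** Non-degeneracy is a count over relative interiors of faces, whereas cells need linear algebra at
    a point. The bridge is the face cut out by the inequalities tight at a point: the point lies in
    its relative interior, so the count gives the dimension of the directions that keep these
    inequalities tight. The dimensions [n] of [P] and [m + 1] of [Q'] add up to one more than the
    number [m + n] of labels; this surplus of one makes cells one-dimensional and lets at most one
    label be tight twice. Since paths and cycles require actual homeomorphisms with the line and the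
    circle, a chain carries its parametrisation along and extends it by gluing over closed sets; for
    a cycle one edge is withheld, and the circle is closed by that edge as a second arc. The
    distinct extremes of [beta] act twice: they make the two half-lines different, and they exclude
    cells that contain a whole line. *)

Lemma glue_continuous (T U : topologicalType) (A B : set T) (f f' : T -> U) :
  closed A -> closed B -> {within A, continuous f} ->
  {within B, continuous f'} -> (forall x, A x -> B x -> f x = f' x) ->
  {within A `|` B, continuous (fun x => if `[< A x >] then f x else f' x)}.
Proof.
move=> cA cB ctf ctf' ff'; apply: withinU_continuous => //.
  apply: (subspace_eq_continuous (f := f)) => // x.
  by rewrite inE => Ax; rewrite /from_subspace asboolT.
apply: (subspace_eq_continuous (f := f')) => // x.
by rewrite inE => Bx; rewrite /from_subspace; case: asboolP => // /ff' ->.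
Qed.

(** The last hypothesis makes a point common to both images come from a common parameter. Hence the
    two inverses agree on the overlap and glue by the same rule as the maps. *)
Lemma glue_homeomorphism (T U : topologicalType) (A B : set T) (X Y : set U) f g f' g' :
  closed A -> closed B -> closed X -> closed Y ->
  homeomorphism A X f g -> homeomorphism B Y f' g' ->
  (forall x, A x -> B x -> f x = f' x) ->
  (forall y, X y -> Y y -> exists x, [/\ A x, B x & f x = y]) ->
  exists f2 g2, [/\ homeomorphism (A `|` B) (X `|` Y) f2 g2,
    forall x, A x -> f2 x = f x & forall x, B x -> f2 x = f' x].
Proof.
move=> cA cB cX cY [ctf ctg fA gX] [ctf' ctg' fB gY] ff' XY.
have gg' y : X y -> Y y -> g y = g' y.
  move=> Xy Yy; have [x [Ax Bx xy]] := XY _ Xy Yy.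
  by rewrite -xy (fA x Ax).2 ff'// (fB x Bx).2.
exists (fun x => if `[< A x >] then f x else f' x).
exists (fun y => if `[< X y >] then g y else g' y).
have eB x : B x -> (if `[< A x >] then f x else f' x) = f' x.
  by move=> Bx; case: asboolP => // /ff' ->.
have eY y : Y y -> (if `[< X y >] then g y else g' y) = g' y.
  by move=> Yy; case: asboolP => // /gg' ->.
split => //; last by move=> x Ax; rewrite asboolT.
split; [exact: glue_continuous|exact: glue_continuous| |].
- move=> x [Ax|Bx].
    by have [Xx gx] := fA _ Ax; rewrite !asboolT//; split; first left.
  by have [Yx gx] := fB _ Bx; rewrite eB// eY//; split; first right.
- move=> y [Xy|Yy].
    by have [Ay fy] := gX _ Xy; rewrite !asboolT//; split; first left.
  by have [By fy] := gY _ Yy; rewrite eY// eB//; split; first right.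
Qed.

Lemma within_continuous_comp (S T U : topologicalType) (A : set S) (B : set T)
    (h : S -> T) (f : T -> U) :
  {within A, continuous h} -> {within B, continuous f} ->
  (forall x, A x -> B (h x)) -> {within A, continuous (f \o h)}.
Proof.
move=> /subspace_continuousP ch /subspace_continuousP cf hAB.
apply/subspace_continuousP => x Ax /=.
apply: cvg_comp (cf _ (hAB _ Ax)) => W /= /(ch x Ax) hW.
have : within A (nbhs x) (fun y => (B (h y) -> W (h y)) /\ A y).
  by apply: filterI => //; exact: withinT.
by apply: filterS => y [+ Ay]; apply; exact: hAB.
Qed.

Lemma homeomorphism_comp (S T U : topologicalType) (A : set S) (B : set T)
    (C : set U) f g f' g' :
  homeomorphism A B f g -> homeomorphism B C f' g' ->
  homeomorphism A C (f' \o f) (g \o g').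
Proof.
move=> [cf cg fA gB] [cf' cg' fB gC]; split.
- by apply: within_continuous_comp cf cf' _ => x /fA[].
- by apply: within_continuous_comp cg' cg _ => x /gC[].
- by move=> x /fA[/fB[? /= ->] ->].
- by move=> y /gC[/gB[? /= ->] ->].
Qed.

Lemma homeomorphism_image (T U : topologicalType) (A : set T) (X : set U) f g :
  homeomorphism A X f g -> X = f @` A.
Proof.
move=> [_ _ fA gX]; apply/seteqP; split=> [y /gX[? ?]|_ [x /fA[? _] <-]//].
by exists (g y).
Qed.

Lemma homeomorphism_connected (T U : topologicalType) (A : set T) (X : set U)
    f g :
  homeomorphism A X f g -> connected A -> connected X.
Proof.
move=> fg cA; rewrite (homeomorphism_image fg).
by apply: connected_continuous_connected => //; case: fg.
Qed.

(** [X] is closed in [A], and open in it as the trace of the complement of [Y]. A component that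
    meets [X] therefore lies in [X], and connectedness of [X] gives the converse. *)
Lemma clopen_is_component (T : topologicalType) (A X Y : set T) :
  A = X `|` Y -> X `&` Y = set0 -> closed X -> closed Y ->
  connected X -> X !=set0 -> is_component A X.
Proof.
move=> AE XY0 cX cY conX X0; split=> // x Xx.
have Ax : A x by rewrite AE; left.
apply/seteqP; split; first by apply: connected_component_max => //; rewrite AE.
set C := connected_component A x.
have CA : C `<=` A by exact: connected_component_sub.
have CX : C `&` X = C.
  apply: (@component_connected _ A x (C `&` X)).
  - by exists x; split=> //; apply: connected_component_refl.
  - exists (~` Y); first exact: closed_openC.
    apply/seteqP; split=> z [Cz Xz]; split=> //.
      by move=> Yz; have : (X `&` Y) z by []; rewrite XY0.
    by have := CA _ Cz; rewrite AE => -[].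
  - by exists X.
by rewrite -/C -CX => z [].
Qed.

(** * Segments and half-lines parametrised by real intervals *)

Section Lines.
Variables (R : realType) (V : normedModType R).

Definition halfline (a d : V) : set V := [set a + r *: d | r in [set r : R | 0 <= r]].

Definition closed_segment (a b : V) : set V :=
  [set a + r *: (b - a) | r in [set r : R | 0 <= r <= 1]].

Lemma closed_segment_sym a b : closed_segment a b = closed_segment b a.
Proof.
suff sub x y : closed_segment x y `<=` closed_segment y x by apply/seteqP.
move=> _ [r /= /andP[r0 r1] <-]; exists (1 - r) => /=; first lra.
by rewrite scalerBl scale1r -scalerN opprB addrA (addrC y) subrK.
Qed.

Lemma closed_segment_l a b : closed_segment a b a.
Proof. by exists 0; rewrite /= ?scale0r ?addr0// lexx ler01. Qed.

Lemma closed_segment_r a b : closed_segment a b b.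
Proof. by rewrite closed_segment_sym; exact: closed_segment_l. Qed.

(* The norm provides the inverse of the parametrisation, as [r >= 0]. *)
Lemma line_homeomorphism (I : set R) (s c : R) (a d : V) :
  s * s = 1 -> d != 0 -> (forall r, I r -> 0 <= r) ->
  homeomorphism [set t : R | I (s * (t - c))] [set a + r *: d | r in I]
    (fun t => a + (s * (t - c)) *: d) (fun v => c + s * (`|v - a| / `|d|)).
Proof.
move=> ss d0 I0; have nd : `|d| != 0 by rewrite normr_eq0.
have gK r : I r -> `|a + r *: d - a| / `|d| = r.
  by move=> /I0 r0; rewrite addrAC subrr add0r normrZ ger0_norm// mulfK.
split.
- apply: continuous_subspaceT => t.
  apply: cvgD; first exact: cvg_cst.
  apply: cvgZr_tmp; apply: cvgMl_tmp; apply: cvgB; first exact: cvg_id.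
  exact: cvg_cst.
- apply: continuous_subspaceT => v.
  apply: cvgD; first exact: cvg_cst.
  apply: cvgMl_tmp; apply: cvgMr_tmp; apply: cvg_norm.
  by apply: cvgB; [exact: cvg_id|exact: cvg_cst].
- move=> t It; split; first by exists (s * (t - c)).
  by rewrite gK// mulrA ss mul1r addrC subrK.
- move=> _ [r Ir <-]; rewrite !gK//.
  have -> : s * (c + s * r - c) = r by rewrite addrAC subrr add0r mulrA ss mul1r.
  by rewrite /= addrAC subrr add0r mulrA ss mul1r.
Qed.

End Lines.

(** * The circle as a union of two closed arcs *)

Section Circle.
Variable R : realType.

(** The sign [s] selects the upper or the lower closed half; the first coordinate is a chart on
    each. *)
Lemma half_circle_homeomorphism (s : R) : s * s = 1 ->
  homeomorphism [set p : R * R | unit_circle p /\ 0 <= s * p.2]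
    [set t : R | -1 <= t <= 1] fst (fun t => (t, s * Num.sqrt (1 - t ^+ 2))).
Proof.
move=> ss; split.
- by apply: continuous_subspaceT => p; exact: cvg_fst.
- apply: continuous_subspaceT => t; apply: (cvg_pair (f := id)
    (F := nbhs t) (G := nbhs t) (H := nbhs (s * Num.sqrt (1 - t ^+ 2)))).
    exact: cvg_id.
  apply: cvgMl_tmp; apply: (continuous_comp (f := fun t : R => 1 - t ^+ 2));
    last exact: sqrt_continuous.
  apply: cvgB; first exact: cvg_cst.
  by apply: (@exprn_continuous R 2).
- move=> [x y] /= []; rewrite /unit_circle /= => xy sy.
  have e : 1 - x ^+ 2 = (s * y) ^+ 2 by rewrite exprMn (expr2 s) ss mul1r -xy; ring.
  split; last by rewrite e sqrtr_sqr ger0_norm// mulrA ss mul1r.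
  by have := sqr_ge0 (s * y); rewrite -e; nra.
- move=> t /= t1; split=> //; rewrite /unit_circle /=.
  have t2 : 0 <= 1 - t ^+ 2 by nra.
  rewrite exprMn (expr2 s) ss mul1r sqr_sqrtr// mulrA ss mul1r.
  by split; [ring|exact: sqrtr_ge0].
Qed.

Lemma segment_homeomorphism (p q : R) : p < q ->
  homeomorphism [set t : R | -1 <= t <= 1] [set t | p <= t <= q]
    (fun t => p + (q - p) * ((t + 1) / 2))
    (fun u => (u - p) / (q - p) * 2 - 1).
Proof.
move=> pq; have qp : q - p != 0 by rewrite subr_eq0 gt_eqF.
have qp0 : 0 < q - p by rewrite subr_gt0.
split.
- apply: continuous_subspaceT => t; apply: cvgD; first exact: cvg_cst.
  apply: cvgMl_tmp; apply: cvgMr_tmp; apply: cvgD; first exact: cvg_id.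
  exact: cvg_cst.
- apply: continuous_subspaceT => t; apply: cvgB; last exact: cvg_cst.
  apply: cvgMr_tmp; apply: cvgMr_tmp; apply: cvgB; first exact: cvg_id.
  exact: cvg_cst.
- move=> t /= t1; split; first by nra.
  by field.
- move=> u /= u1; split; last by field.
  have : 0 <= (u - p) / (q - p) <= 1.
    by rewrite divr_ge0 ?ler_pdivrMr//; lra.
  by lra.
Qed.

(** The two arcs share only the points with abscissa -1 and 1, which the affine charts send to the
    left and right ends of each interval. Hence both curves are traversed from the same start to the
    same end, not head to tail. *)
Lemma glue_circle (U : topologicalType) (X Y : set U) f g f' g' (p q p' q' : R) :
  p < q -> p' < q' -> closed X -> closed Y ->
  homeomorphism [set t | p <= t <= q] X f g ->
  homeomorphism [set t | p' <= t <= q'] Y f' g' ->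
  f p = f' p' -> f q = f' q' -> X `&` Y `<=` [set f p; f q] ->
  exists f2 g2, homeomorphism (@unit_circle R) (X `|` Y) f2 g2.
Proof.
move=> pq pq' cX cY hX hY ep eq XY.
pose H (s : R) := [set z : R * R | unit_circle z /\ 0 <= s * z.2].
have cH s : closed (H s).
  have -> : H s = (fun z => z.1 ^+ 2 + z.2 ^+ 2) @^-1` [set 1 : R] `&`
                  (fun z => s * z.2) @^-1` [set r | 0 <= r] by [].
  apply: closedI; apply: closed_comp.
  - move=> z _; apply: cvgD.
      apply: (@continuous_comp _ _ _ fst (fun x : R => x ^+ 2)); first exact: cvg_fst.
      exact: exprn_continuous.
    apply: (@continuous_comp _ _ _ snd (fun x : R => x ^+ 2)); first exact: cvg_snd.
    exact: exprn_continuous.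
  - exact: closed_eq.
  - by move=> z _; apply: cvgMl_tmp; exact: cvg_snd.
  - exact: closed_ge.
have N11 : -1 * -1 = 1 :> R by rewrite mulrNN mulr1.
have h1 := homeomorphism_comp (homeomorphism_comp
  (half_circle_homeomorphism (mulr1 1)) (segment_homeomorphism pq)) hX.
have h2 := homeomorphism_comp (homeomorphism_comp
  (half_circle_homeomorphism N11) (segment_homeomorphism pq')) hY.
have -> : @unit_circle R = H 1 `|` H (-1).
  apply/seteqP; split=> z /=; last by move=> [[]|[]].
  move=> uz; have [z0|z0] := leP 0 z.2; [left|right]; split=> //; lra.
have e0 (a b : R) : a + (b - a) * ((-1 + 1) / 2) = a by field.
have e1 (a b : R) : a + (b - a) * ((1 + 1) / 2) = b by field.
have [||f2 [g2 [h _ _]]] := glue_homeomorphism (cH 1) (cH (-1)) cX cY h1 h2.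
- move=> [x y] /= [uz /= y0] [_ /= y1].
  have y00 : y = 0 by lra.
  move: uz; rewrite /unit_circle /= y00 expr0n addr0 => /eqP.
  by rewrite sqrf_eq1 => /orP[]/eqP ->; rewrite ?e0 ?e1.
- move=> y Xy Yy; have [->|->] := XY y (conj Xy Yy).
    by exists (-1, 0); rewrite /= e0 /H /= /unit_circle /= !mulr0 expr0n addr0 sqrrN expr1n.
  by exists (1, 0); rewrite /= e1 /H /= /unit_circle /= !mulr0 expr0n addr0 expr1n.
by exists f2, g2.
Qed.

End Circle.

(** * Chains of segments and half-lines *)

Lemma closed_segment_bounded (R : realType) (V : normedModType R) (a b : V) :
  bounded_set (closed_segment a b).
Proof.
exists (`|a| + `|b - a|); split; first exact: num_real.
move=> M ltM _ [r /= /andP[r0 r1] <-]; apply: ltW; apply: le_lt_trans ltM.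
apply: le_trans (ler_normD _ _) _; rewrite lerD2l normrZ ger0_norm//.
by rewrite ler_piMl.
Qed.

Lemma halfline_unbounded (R : realType) (V : normedModType R) (a d : V) :
  d != 0 -> ~ bounded_set (halfline a d).
Proof.
move=> d0 [M [_ Mb]].
have nd : 0 < `|d| by rewrite normr_gt0.
pose B := `|M| + 1; have MB : M < B by rewrite /B; have := ler_norm M; lra.
have B0 : 0 <= B by rewrite /B addr_ge0.
have r0 : 0 <= (B + `|a| + 1) / `|d| by rewrite divr_ge0//; have := normr_ge0 a; lra.
have h : `|a + ((B + `|a| + 1) / `|d|) *: d| <= B.
  by apply: (Mb B MB); exists ((B + `|a| + 1) / `|d|).
have := lerB_dist (((B + `|a| + 1) / `|d|) *: d) (- a).
rewrite opprK normrN normrZ (ger0_norm r0) divfK ?gt_eqF// addrC.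
by rewrite (addrC _ a); move: h; lra.
Qed.

Section Graph.
Variables (R : realType) (V : normedModType R) (K : set V) (T : finType).
Variables (E ends : T -> set V) (ray : pred T).
Hypothesis E_closed : forall x, closed (E x).
Hypothesis E_edge : forall x, is_edge K (E x).
Hypothesis segmentP : forall x, ~~ ray x ->
  exists a b, [/\ a != b, E x = closed_segment a b & ends x = [set a; b]].
Hypothesis rayP : forall x, ray x ->
  exists a d, [/\ d != 0, E x = halfline a d & ends x = [set a]].
Hypothesis meet_ends : forall x y z, x != y -> E x z -> E y z -> ends x z.
Hypothesis ends_meet : forall x z, ends x z -> exists2 y, y != x & E y z.
Hypothesis meet_two : forall x y w z,
  x != y -> E x z -> E y z -> E w z -> w = x \/ w = y.

Definition cover_by (S : {set T}) : set V := \bigcup_(x in [set` S]) E x.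

(** Closure under adjacency. It makes the cover of [S] disjoint from the cover of the remaining
    edges; both are closed as finite unions, so a connected such cover is a component. *)
Definition saturated (S : {set T}) :=
  forall x y z, x \in S -> E x z -> E y z -> y \in S.

Lemma cover_by_closed S : closed (cover_by S).
Proof. by apply: closed_bigcup => // x _; exact: E_closed. Qed.

Lemma cover_byU1 x S : cover_by (x |: S) = cover_by S `|` E x.
Proof.
apply/seteqP; split=> [z [y /=]|z [[y /= yS Eyz]|Exz]].
- by rewrite finset.in_setU1 => /orP[/eqP->|yS] Eyz; [right|left; exists y].
- by exists y => //=; rewrite finset.in_setU1 yS orbT.
- by exists x => //=; rewrite finset.setU11.
Qed.

Lemma cover_by1 x : cover_by [set x]%SET = E x.
Proof.
apply/seteqP; split=> [z [y /=]|z Exz]; first by rewrite finset.in_set1 => /eqP ->.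
by exists x => //=; rewrite finset.in_set1.
Qed.

Lemma segment_other_end x q : ~~ ray x -> ends x q ->
  exists q', [/\ q != q', E x = closed_segment q q' & ends x = [set q; q']].
Proof.
move=> /segmentP[a [b [ab Ex ex]]]; rewrite ex => -[->|->]; first by exists b.
by exists a; rewrite eq_sym closed_segment_sym setUC.
Qed.

(** * Growing a chain of edges at its free end *)

Section Chain.
Variables (D : {set T}) (lo : set R) (y0 : T) (f0 : R -> V).
Hypothesis lo_closed : closed lo.
Hypothesis lo_up : forall t u, lo t -> t <= u -> lo u.
Hypothesis lo0 : lo 0.

(* [x] is the last edge of the chain and [f c] its free end; edges in [D] are
   disregarded in the maximality clause. *)
Definition chain (S : {set T}) (c : R) (f : R -> V) (g : V -> R) (x : T) :=
  [/\ [/\ 0 <= c, y0 \in S & forall y, y \in S -> y \notin D],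
      homeomorphism [set t | lo t /\ t <= c] (cover_by S) f g,
      forall t, lo t -> t <= 0 -> f t = f0 t,
      [/\ x \in S, ends x (f c) & forall y, y \in S -> E y (f c) -> y = x]
    & forall x' y z, x' \in S -> E x' z -> z <> f c -> E y z ->
        y \notin D -> y \in S].

(** The adjacent edge [y] cannot touch the chain elsewhere: away from [f c] the maximality clause
    would already place it in [S]. So if [y] is a segment outside [D], its parametrisation on
    [[c, c + 1]] glues to the old one and its other end becomes the free end. [lo] is the whole line
    for a path and [[-1, +oo)] for a cycle; [f0] keeps the start of the chain fixed while it
    grows. *)
Lemma chain_step S c f g x : chain S c f g x ->
  exists y, [/\ y \notin S, y != x, E y (f c) &
    [\/ y \in D, ray y | exists c' f' g', chain (y |: S) c' f' g' y]].
Proof.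
move=> [[c0 y0S SD] hfg ff0 [xS exq xu] maxS].
have [y yx Eyq] := ends_meet exq; exists y.
have yS : y \notin S by apply/negP => /xu /(_ Eyq) /eqP; exact/negP.
split=> //.
case: (boolP (y \in D)) => yD; first by constructor 1.
case: (boolP (ray y)) => ry; first by constructor 2.
constructor 3.
have Exq : E x (f c).
  have [_ _ fA _] := hfg; have [|[z /= zS Ezq] _] := fA c.
    by split=> //; exact: lo_up c0.
  by rewrite -(xu z).
have eyq : ends y (f c) by exact: meet_ends Eyq Exq.
have [q' [qq' Ey ey]] := segment_other_end ry eyq.
have q'q : q' - f c != 0 by rewrite subr_eq0 eq_sym.
have h2 := line_homeomorphism c (f c) (mulr1 1) q'q
  (fun r : R => (fun H : 0 <= r <= 1 => (andP H).1)).
have meetq z x' : x' \in S -> E x' z -> E y z -> z = f c.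
  move=> x'S Ex'z Eyz; apply: contrapT => zq.
  by have := maxS _ _ _ x'S Ex'z zq Eyz yD; apply/negP.
have clA : closed [set t | lo t /\ t <= c].
  by apply: closedI => //; exact: closed_le.
have clB : closed [set t | 0 <= 1 * (t - c) <= 1].
  rewrite (_ : mkset _ = `[c, c + 1]%classic); first exact: interval_closed.
  by apply/seteqP; split=> t /=; rewrite in_itv /= mul1r; lra.
rewrite -/(closed_segment (f c) q') -Ey in h2.
have [||f2 [g2 [h f2A f2B]]] :=
  glue_homeomorphism clA clB (@cover_by_closed S) (E_closed (x := y)) hfg h2.
- move=> t [_ tc] /= /andP[tc' _].
  have -> : t = c by lra.
  by rewrite subrr mulr0 scale0r addr0.
- move=> z [x' x'S Ex'z] Eyz; rewrite (meetq _ _ x'S Ex'z Eyz).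
  exists c; split=> //=; first by split=> //; exact: lo_up c0.
  by rewrite subrr mulr0 lexx ler01.
have f2c1 : f2 (c + 1) = q'.
  rewrite f2B /=; last by rewrite mul1r; lra.
  by rewrite (addrC c) addrK mul1r scale1r addrC subrK.
exists (c + 1), f2, g2; split.
- split; [by lra|by rewrite finset.in_setU1 y0S orbT|].
  by move=> z; rewrite finset.in_setU1 => /orP[/eqP->//|/SD].
- rewrite cover_byU1 (_ : mkset _ =
    [set t | lo t /\ t <= c] `|` [set t | 0 <= 1 * (t - c) <= 1])//.
  apply/seteqP; split=> t /=.
    by move=> [lt tc]; have [tc1|tc1] := leP t c; [left; split|right] => //; lra.
  move=> [[? ?]|ht]; first by split=> //; lra.
  by split; [apply: lo_up lo0 _|]; lra.
- by move=> t lt t0; rewrite f2A ?ff0//; split=> //; lra.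
- rewrite f2c1; split; [by rewrite finset.setU11|by rewrite ey; right|].
  move=> w; rewrite finset.in_setU1 => /orP[/eqP//|wS] Ewq'.
  exfalso; have : f c <> q' by apply/eqP.
  by apply; rewrite (meetq q' w)// Ey; exact: closed_segment_r.
- rewrite f2c1 => x' w z x'S' Ex'z zq' Ewz wD.
  rewrite finset.in_setU1; apply/orP.
  (* At the old free end [x] and [y] are the only edges, so this point is now complete and can leave
     the exception clause. *)
  have atq : z = f c -> w = y \/ w \in S.
    move=> zq; rewrite zq in Ewz.
    by have [->|->] := meet_two yx Eyq Exq Ewz; [left|right].
  suff : w = y \/ w \in S by case=> ->; [left; exact: eqxx|right].
  move: x'S'; rewrite finset.in_setU1 => /orP[/eqP x'y|x'S].
    have [->|wy] := eqVneq w y; first by left.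
    rewrite x'y in Ex'z; have : ends y z by apply: meet_ends Ex'z Ewz; rewrite eq_sym.
    by rewrite ey => -[/atq//|].
  have [/eqP /atq//|/eqP zq] := boolP (z == f c).
  by right; exact: maxS Ex'z zq Ewz wD.
Qed.

(** Each extension takes an edge from the finite complement of [S], so the growth stops, and only a
    ray or an edge of [D] can stop it. *)
Lemma chain_end S c f g x : chain S c f g x ->
  exists S' c' f' g' x' y, [/\ chain S' c' f' g' x', y \notin S', y != x',
    E y (f' c') & y \in D \/ ray y].
Proof.
have [k] := ubnP #|~: S|; elim: k S c f g x => // k IH S c f g x leS ch.
have [y [yS yx Ey [yD|yr|]]] := chain_step ch.
- by exists S, c, f, g, x, y; split=> //; left.
- by exists S, c, f, g, x, y; split=> //; right.
move=> [c' [f' [g' ch']]]; apply: IH ch'.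
apply: leq_trans (leS : (#|~: S| <= k)%N); apply: proper_card.
rewrite finset.properEneq; apply/andP; split; last by rewrite finset.setCS finset.subsetUr.
by apply/eqP => /setP /(_ y); rewrite !inE eqxx (negbTE yS).
Qed.

End Chain.

(** The half-line [r1] is traversed inwards and the chain is grown with [D] empty. It stops at a
    half-line outside the chain, necessarily [r2], which is glued on as the outgoing end. *)
Lemma path_exists r1 r2 : r1 != r2 -> (forall x, ray x = (x == r1) || (x == r2)) ->
  exists S : {set T}, [/\ forall x, ray x -> x \in S, saturated S, is_path K (cover_by S)
    & connected (cover_by S)].
Proof.
move=> r12 rayE.
have rr1 : ray r1 by rewrite rayE eqxx.
have [a [d [d0 Er er]]] := rayP rr1.
(* The factor -1 reverses the half-line: parameters come in from infinity and reach its end [a] at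
   0. *)
pose f0 := fun t : R => a + (-1 * (t - 0)) *: d.
have N11 : -1 * -1 = 1 :> R by rewrite mulrNN mulr1.
have h0 := line_homeomorphism 0 a N11 d0 (fun r : R => (fun H : 0 <= r => H)).
have eq0 : mkset (fun t : R => 0 <= -1 * (t - 0)) = [set t | setT t /\ t <= 0].
  by apply/seteqP; split=> t /=; [move=> ?; split=> //|move=> [_ ?]]; lra.
rewrite -/(halfline a d) -Er eq0 -cover_by1 in h0.
have f00 : f0 0 = a by rewrite /f0 subrr mulr0 scale0r addr0.
have ch0 : chain finset.set0 setT r1 f0 [set r1]%SET 0 f0
    (fun v => 0 + -1 * (`|v - a| / `|d|)) r1.
  split=> //.
  - by split=> //; [rewrite finset.in_set1|move=> y _; rewrite finset.in_set0].
  - split; [by rewrite finset.in_set1|by rewrite f00 er|].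
    by move=> y; rewrite finset.in_set1 => /eqP.
  - move=> x' y z; rewrite !finset.in_set1 => /eqP-> Er1z; rewrite f00 => za Eyz _.
    apply: contrapT => /negP yr; apply: za.
    have := meet_ends _ Er1z Eyz; rewrite eq_sym er; exact.
have [S [c [f [g [x [y [ch yS yx Eyq]]]]]]] := chain_end (@closedT _) (fun _ _ _ _ => I) I ch0.
move=> [|ry]; first by rewrite finset.in_set0.
have [[c_ge0 r1S SD] hfg ff0 [xS exq xu] maxS] := ch.
have yr2 : y = r2.
  by move: ry yS; rewrite rayE => /orP[/eqP->|/eqP//]; rewrite r1S.
have Exq : E x (f c).
  have [_ _ fA _] := hfg; have [//|[z /= zS Ezq] _] := fA c.
  by rewrite -(xu z).
have eyq : ends y (f c) by exact: meet_ends Eyq Exq.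
have [a' [d' [d'0 Ey ey]]] := rayP ry.
rewrite ey in eyq; rewrite -eyq in Ey ey.
have h2 := line_homeomorphism c (f c) (mulr1 1) d'0 (fun r : R => (fun H : 0 <= r => H)).
rewrite -/(halfline (f c) d') -Ey in h2.
have clA : closed [set t : R | setT t /\ t <= c].
  by apply: closedI; [exact: closedT|exact: closed_le].
have clB : closed (mkset (fun t => 0 <= 1 * (t - c))).
  rewrite (_ : mkset _ = [set t | c <= t]); first exact: closed_ge.
  by apply/seteqP; split=> t /=; lra.
have meetq z x' : x' \in S -> E x' z -> E y z -> z = f c.
  move=> x'S Ex'z Eyz; apply: contrapT => zq.
  by have := maxS _ _ _ x'S Ex'z zq Eyz; rewrite finset.in_set0 (negbTE yS) => /(_ isT).
have [||f2 [g2 [h f2A f2B]]] :=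
  glue_homeomorphism clA clB (@cover_by_closed S) (E_closed (x := y)) hfg h2.
- move=> t [_ tc] /= tc'.
  have -> : t = c by lra.
  by rewrite subrr mulr0 scale0r addr0.
- move=> z [x' x'S Ex'z] Eyz; rewrite (meetq _ _ x'S Ex'z Eyz).
  by exists c; split=> //=; rewrite subrr mulr0.
rewrite -cover_byU1 in h.
have TE : [set t : R | setT t /\ t <= c] `|` (mkset (fun t => 0 <= 1 * (t - c))) = setT.
  by apply/seteqP; split=> t //= _; have [tc|tc] := leP t c; [left|right]=> //; lra.
rewrite TE in h.
have conn : connected (cover_by (y |: S)).
  by apply: (homeomorphism_connected h); apply/connected_intervalP => ? ? *.
exists (y |: S); split=> //.
- by move=> w; rewrite rayE finset.in_setU1 yr2 => /orP[/eqP->|->//]; rewrite r1S orbT.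
- move=> x' w z x'S' Ex'z Ewz.
  rewrite finset.in_setU1; apply/orP.
  have atq : z = f c -> w = y \/ w \in S.
    move=> zq; rewrite zq in Ewz.
    by have [->|->] := meet_two yx Eyq Exq Ewz; [left|right].
  suff : w = y \/ w \in S by case=> ->; [left; exact: eqxx|right].
  move: x'S'; rewrite finset.in_setU1 => /orP[/eqP x'y|x'S].
    have [->|wy] := eqVneq w y; first by left.
    rewrite x'y in Ex'z; have : ends y z by apply: meet_ends Ex'z Ewz; rewrite eq_sym.
    by rewrite ey => /atq.
  have [/eqP /atq//|/eqP zq] := boolP (z == f c).
  by right; apply: maxS Ex'z zq Ewz _ => //; rewrite finset.in_set0.
exists [set E x | x in [set` y |: S]], f2, g2; split=> //.
- by move=> _ [w _ <-]; right; exact: E_edge.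
- by rewrite bigcup_image.
split.
- exists (E r1), 0; split; [|exact: E_edge|by rewrite Er; exact: halfline_unbounded|].
    by exists r1 => //=; rewrite finset.in_setU1 r1S orbT.
  move=> t t0; rewrite f2A; last by split=> //; lra.
  by rewrite ff0// Er; exists (-1 * (t - 0)) => //=; lra.
- exists (E y), c; split; [|exact: E_edge|by rewrite Ey; exact: halfline_unbounded|].
    by exists y => //=; rewrite finset.setU11.
  move=> t tc; rewrite f2B /=; last lra.
  by rewrite Ey; exists (1 * (t - c)) => //=; lra.
Qed.

(** The segment [x] is withheld together with [P], and a chain is grown from the neighbour of [x] at
    its end [b]. As [P] is saturated and contains all rays, only [x] can stop the chain, and [x]
    then closes it up. *)
Lemma cycle_exists (P : {set T}) x : saturated P -> (forall y, ray y -> y \in P) ->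
  x \notin P ->
  exists S : {set T}, [/\ x \in S, forall y, y \in S -> y \notin P, saturated S,
    is_cycle K (cover_by S) & connected (cover_by S)].
Proof.
move=> satP rayP' xP.
have nray y : y \notin P -> ~~ ray y by apply: contra => /rayP'.
have [a [b [ab Ex ex]]] := segmentP (nray _ xP).
have exb : ends x b by rewrite ex; right.
have Exb : E x b by rewrite Ex; exact: closed_segment_r.
have [y0 y0x Ey0b] := ends_meet exb.
have y0P : y0 \notin P by apply: contra xP => /satP /(_ Ey0b Exb).
have ey0b : ends y0 b by exact: meet_ends Ey0b Exb.
have [b' [bb' Ey0 ey0]] := segment_other_end (nray _ y0P) ey0b.
have b'b : b' - b != 0 by rewrite subr_eq0 eq_sym.
pose f0 := fun t : R => b + (1 * (t - -1)) *: (b' - b).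
have h0 := line_homeomorphism (-1) b (mulr1 1) b'b
  (fun r : R => (fun H : 0 <= r <= 1 => (andP H).1)).
have eq0 : mkset (fun t : R => 0 <= 1 * (t - -1) <= 1) = [set t | -1 <= t /\ t <= 0].
  apply/seteqP; split=> t /=; first by move=> ?; split; lra.
  by move=> [? ?]; lra.
rewrite -/(closed_segment b b') -Ey0 eq0 -cover_by1 in h0.
have f00 : f0 0 = b' by rewrite /f0 opprK add0r mul1r scale1r addrC subrK.
have f01 : f0 (-1) = b by rewrite /f0 subrr mulr0 scale0r addr0.
have ch0 : chain (x |: P) [set t | -1 <= t] y0 f0 [set y0]%SET 0 f0
    (fun v => -1 + 1 * (`|v - b| / `|b' - b|)) y0.
  split=> //.
  - split=> //; first by rewrite finset.in_set1.
    by move=> y; rewrite finset.in_set1 => /eqP->; rewrite finset.in_setU1 negb_or y0x.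
  - split; [by rewrite finset.in_set1|by rewrite f00 ey0; right|].
    by move=> y; rewrite finset.in_set1 => /eqP.
  - move=> x' y z; rewrite !finset.in_set1 => /eqP-> Ey0z; rewrite f00 => zb Eyz.
    rewrite finset.in_setU1 negb_or => /andP[yx _].
    apply: contrapT => /negP yy0.
    have : ends y0 z by apply: meet_ends Ey0z Eyz; rewrite eq_sym.
    rewrite ey0 => -[zb'|//]; rewrite zb' in Eyz.
    by have [/eqP|/eqP] := meet_two y0x Ey0b Exb Eyz; apply/negP.
have lo_up (t u : R) : [set t | -1 <= t] t -> t <= u -> [set t | -1 <= t] u.
  by move=> /=; lra.
have lo0 : [set t : R | -1 <= t] 0 by move=> /=; lra.
have [S [c [f [g [x1 [y [ch yS yx1 Eyq]]]]]]] := chain_end (closed_ge (y:=_)) lo_up lo0 ch0.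
have [[c_ge0 y0S SD] hfg ff0 [x1S ex1q xu] maxS] := ch.
have Ex1q : E x1 (f c).
  have [_ _ fA _] := hfg; have [|[z /= zS Ezq] _] := fA c; first by split=> //=; lra.
  by rewrite -(xu z).
have SP z : z \in S -> z \notin P by move=> /SD; rewrite finset.in_setU1 negb_or => /andP[].
have Sx z : z \in S -> z != x by move=> /SD; rewrite finset.in_setU1 negb_or => /andP[].
move=> yDr; have {yDr yx1} yx : y = x.
  have yP : y \in P -> False.
    by move=> /satP /(_ Eyq Ex1q); apply/negP; exact: SP.
  by move: yDr => [|/rayP' /yP//]; rewrite finset.in_setU1 => /orP[/eqP|/yP].
subst y.
have fN1 : f (-1) = b by rewrite ff0//=; lra.
(* The chain returns at the other end [a]: a return to [b] would give [c] and -1 the same image,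
   against injectivity. *)
have fca : f c = a.
  have : ends x (f c) by apply: meet_ends Eyq Ex1q; rewrite eq_sym Sx.
  rewrite ex => -[//|fcb]; exfalso.
  have [_ _ fA _] := hfg.
  have [_ gc] : cover_by S (f c) /\ g (f c) = c by apply: fA; split=> //=; lra.
  have [_ g1] : cover_by S (f (-1)) /\ g (f (-1)) = -1 by apply: fA; split=> //=; lra.
  by move: c_ge0; rewrite -gc fcb -fN1 g1; lra.
have ba0 : a - b != 0 by rewrite subr_eq0.
have h2 := line_homeomorphism 0 b (mulr1 1) ba0
  (fun r : R => (fun H : 0 <= r <= 1 => (andP H).1)).
rewrite -/(closed_segment b a) closed_segment_sym -Ex in h2.
have eq1 : mkset (fun t : R => 0 <= 1 * (t - 0) <= 1) = [set t | 0 <= t <= 1].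
  by apply/seteqP; split=> t /=; rewrite subr0 mul1r.
have eqc : [set t | -1 <= t /\ t <= c] = [set t | -1 <= t <= c].
  by apply/seteqP; split=> t /= => [[-> ->]|/andP].
rewrite eq1 in h2; rewrite /= eqc in hfg.
have meetS z x' : x' \in S -> E x' z -> E x z -> z = b \/ z = a.
  move=> x'S Ex'z Exz; have : ends x z by apply: meet_ends Exz Ex'z; rewrite eq_sym Sx.
  by rewrite ex => -[]; [right|left].
have N1c : -1 < c by lra.
have [|||f2 [g2 h]] := glue_circle N1c ltr01 (@cover_by_closed S) (E_closed (x := x)) hfg h2.
- by rewrite fN1 subrr mulr0 scale0r addr0.
- by rewrite fca subr0 mul1r scale1r addrC subrK.
- by move=> z [[x' x'S Ex'z] Exz]; rewrite fN1 fca; exact: meetS Ex'z Exz.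
have conn : connected (cover_by (x |: S)).
  rewrite cover_byU1; apply: connectedU.
  - exists b; split=> //; rewrite -fN1.
    by have [_ _ fA _] := hfg; have [|] := fA (-1) => //=; lra.
  - apply: (homeomorphism_connected hfg); rewrite -set_itvcc.
    exact: segment_connected.
  - apply: (homeomorphism_connected h2); rewrite -set_itvcc.
    exact: segment_connected.
rewrite -cover_byU1 in h.
have x1x := Sx _ x1S.
exists (x |: S); split=> //.
- by rewrite finset.setU11.
- by move=> y; rewrite finset.in_setU1 => /orP[/eqP->//|/SP].
- have satS x' y z : x' \in S -> E x' z -> E y z -> y \in x |: S.
    move=> x'S Ex'z Eyz; rewrite finset.in_setU1.
    have [//|yx /=] := eqVneq y x.
    have yD : y \notin x |: P.
      rewrite finset.in_setU1 negb_or yx /=; apply: contra (SP _ x'S) => /satP h'.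
      exact: h' Eyz Ex'z.
    have [/eqP zq|/eqP zq] := boolP (z == f c); last exact: maxS Ex'z zq Eyz yD.
    rewrite zq in Eyz; have [->//|/eqP] := meet_two x1x Ex1q Eyq Eyz.
    by rewrite (negbTE yx).
  move=> x' y z; rewrite finset.in_setU1 => /orP[/eqP->|]; last exact: satS.
  move=> Exz Eyz; have [->|yx] := eqVneq y x; first by rewrite finset.setU11.
  have : ends x z by apply: meet_ends Exz Eyz; rewrite eq_sym.
  rewrite ex => -[za|zb]; [apply: satS x1S _ Eyz|apply: satS y0S _ Eyz].
    by rewrite za -fca.
  by rewrite zb.
- exists [set E x | x in [set` x |: S]], f2, g2; split=> //.
  + exact: finite_image.
  + move=> _ [w /= wS <-]; right; split; first exact: E_edge.
    have wP : w \notin P by move: wS; rewrite finset.in_setU1 => /orP[/eqP->//|/SP].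
    have [a1 [b1 [_ -> _]]] := segmentP (nray _ wP).
    exact: closed_segment_bounded.
  + by rewrite bigcup_image.
Qed.

Theorem cover_decomposition r1 r2 :
  r1 != r2 -> (forall x, ray x = (x == r1) || (x == r2)) ->
  let N := \bigcup_x E x in
  exists (Pth : set V) (k : nat) (Cyc : 'I_k -> set V),
    N = Pth `|` \bigcup_i Cyc i /\
    (forall i, Pth `&` Cyc i = set0) /\
    (forall i j, i != j -> Cyc i `&` Cyc j = set0) /\
    is_component N Pth /\
    (forall i, is_component N (Cyc i)) /\
    is_path K Pth /\
    (forall i, is_cycle K (Cyc i)).
Proof.
move=> r12 rayE N.
have [P [rayP' satP pathP connP]] := path_exists r12 rayE.
pose isC (S : {set T}) := [/\ exists x, x \in S, forall y, y \in S -> y \notin P,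
  saturated S, is_cycle K (cover_by S) & connected (cover_by S)].
(* All admissible edge sets are collected at once rather than peeled off one by one; finiteness of
   [T] bounds their number and [enum_val] numbers the cycles. *)
pose CS := [set S : {set T} | `[< isC S >]]%SET.
have CSP (i : 'I_#|CS|) : isC (enum_val i).
  by have := enum_valP i; rewrite inE => /asboolP.
have E0 x : E x !=set0.
  have [/rayP[a [d [_ -> _]]]|/segmentP[a [b [_ -> _]]]] := boolP (ray x).
    by exists a, 0 => //=; rewrite scale0r addr0.
  by exists a; exact: closed_segment_l.
have disj (S S' : {set T}) : saturated S' -> (forall x, x \in S -> x \notin S') ->
    cover_by S `&` cover_by S' = set0.
  move=> satS' SS'; rewrite -subset0 => z [[x /= xS Exz] [y /= yS' Eyz]].
  by have := satS' _ _ _ yS' Eyz Exz; apply/negP; exact: SS'.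
have comp (S : {set T}) : (exists x, x \in S) -> saturated S ->
    connected (cover_by S) -> is_component N (cover_by S).
  move=> [x xS] satS connS; apply: (clopen_is_component (Y := cover_by (~: S))) => //.
  - apply/seteqP; split=> [z [y _ Eyz]|z [[y _ Eyz]|[y _ Eyz]]]; try by exists y.
    have [yS|yS] := boolP (y \in S); [left|right]; exists y => //=.
    by rewrite inE.
  - rewrite setIC; apply: disj => // y; by rewrite inE.
  - exact: cover_by_closed.
  - exact: cover_by_closed.
  - by have [z Exz] := E0 x; exists z; exists x.
(* Two such covers that meet are both the component of a common point, hence equal; saturation
   carries the equality back to the edge sets. *)
have eqC (S S' : {set T}) : saturated S -> saturated S' ->
    connected (cover_by S) -> connected (cover_by S') ->
    cover_by S `&` cover_by S' !=set0 -> S = S'.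
  move=> satS satS' connS connS' [z [Sz S'z]].
  have Sn0 (Q : {set T}) : cover_by Q z -> exists x, x \in Q by move=> [x]; exists x.
  have SS' : cover_by S = cover_by S'.
    have [_ /(_ _ Sz) ->] := comp S (Sn0 _ Sz) satS connS.
    by have [_ /(_ _ S'z) <-] := comp S' (Sn0 _ S'z) satS' connS'.
  have sub (Q Q' : {set T}) : saturated Q' -> cover_by Q = cover_by Q' ->
      forall x, x \in Q -> x \in Q'.
    move=> satQ' QQ' x xQ; have [w Exw] := E0 x.
    have [y yQ' Eyw] : cover_by Q' w by rewrite -QQ'; exists x.
    exact: satQ' yQ' Eyw Exw.
  by apply/setP => x; apply/idP/idP; apply: sub.
exists (cover_by P), #|CS|, (fun i => cover_by (enum_val i)).
split; [|split; [|split; [|split; [|split; [|split]]]]] => //.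
- apply/seteqP; split=> [z [x _ Exz]|z [[x _ Exz]|[i _ [x _ Exz]]]]; try by exists x.
  have [xP|xP] := boolP (x \in P); first by left; exists x.
  right; have [S [xS SP satS cycS connS]] := cycle_exists satP rayP' xP.
  have SC : S \in CS by rewrite inE; apply/asboolP; split=> //; exists x.
  by exists (enum_rank_in SC S) => //; rewrite enum_rankK_in//; exists x.
- by move=> i; have [_ SP _ _ _] := CSP i; rewrite setIC; exact: disj.
- move=> i j ij; have [_ _ si _ ci] := CSP i; have [_ _ sj _ cj] := CSP j.
  apply: contrapT => /eqP /set0P /(eqC _ _ si sj ci cj) /enum_val_inj.
  by move/eqP; apply/negP.
- by apply: comp => //; exists r1; apply: rayP'; rewrite rayE eqxx.
- by move=> i; have [? _ ? _ ?] := CSP i; exact: comp.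
- by move=> i; have [_ _ _ ? _] := CSP i.
Qed.

End Graph.

(** * Faces of simple polyhedra *)

Section LinearForms.
Variables (R : realType) (V : normedModType R).
Implicit Types f : V -> R.

Definition linear_form f := forall a u v, f (a *: u + v) = a * f u + f v.

Lemma linear_form0 f : linear_form f -> f 0 = 0.
Proof.
by move=> /(_ (-1) 0 0); rewrite scaler0 addr0 mulN1r addNr.
Qed.

Lemma linear_formD f u v : linear_form f -> f (u + v) = f u + f v.
Proof. by move=> /(_ 1 u v); rewrite scale1r mul1r. Qed.

Lemma linear_formZ f a u : linear_form f -> f (a *: u) = a * f u.
Proof. by move=> lf; have := lf a u 0; rewrite !addr0 (linear_form0 lf) addr0. Qed.

Lemma linear_form_sum f (I : finType) (F : I -> V) : linear_form f ->
  f (\sum_i F i) = \sum_i f (F i).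
Proof.
move=> lf; apply: (big_morph f); last exact: linear_form0.
by move=> u v; exact: linear_formD.
Qed.

(** The supporting functional is minus the sum of the forms: a sum of nonnegative terms vanishes
    only if each term does. *)
Lemma is_face_of_forms (K : set V) (I : finType) (g : I -> V -> R) (J : pred I) :
  (forall i, linear_form (g i)) ->
  (forall i v, J i -> K v -> 0 <= g i v) ->
  is_face K [set v | K v /\ forall i, J i -> g i v = 0].
Proof.
move=> lg g0; pose f (v : V) : R^o := - \sum_(i | J i) g i v.
have lf : linear f.
  move=> a u v; rewrite /f scalerN -opprD scaler_sumr -big_split /=; congr (- _).
  by apply: eq_bigr => i _; rewrite lg.
pose F : {linear V -> R^o} := HB.pack f (GRing.isLinear.Build R V R^o *:%R f lf).
exists F, 0; split=> [v Kv|].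
  by rewrite /= oppr_le0 sumr_ge0// => i /g0; exact.
apply/seteqP; split=> v [Kv] /=; rewrite /f => gv; split=> //.
  by rewrite big1 ?oppr0// => i /gv.
move/eqP: gv; rewrite oppr_eq0 psumr_eq0 => [/allP gv i Ji|i /g0]; last exact.
by have := gv i (mem_index_enum i); rewrite Ji => /eqP.
Qed.

(** One nonzero multiple of each direction [w] suffices, since [x0 + w] is the affine combination
    [(1 - 1/r) x0 + (1/r) (x0 + r w)]. *)
Lemma affine_hull_span (F : set V) (x0 : V) d (b : 'I_d -> V) :
  F x0 ->
  (forall y, F y -> exists c : 'I_d -> R, y = x0 + \sum_i c i *: b i) ->
  (forall c : 'I_d -> R, exists2 r : R, r != 0 & F (x0 + r *: \sum_i c i *: b i)) ->
  affine_hull F = [set x0 + \sum_i c i *: b i | c in [set: 'I_d -> R]].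
Proof.
move=> Fx0 Fsub Fsup; apply/seteqP; split=> [_ [k [p [a [Fp a1 ->]]]]|_ [c _ <-]].
  have /choice[c pE] := fun i => Fsub _ (Fp i).
  exists (fun j => \sum_i a i * c i j) => //.
  under [RHS]eq_bigr do rewrite pE scalerDr.
  rewrite big_split /= -scaler_suml a1 scale1r; congr (_ + _).
  under eq_bigr do rewrite scaler_suml.
  rewrite exchange_big /=; apply: eq_bigr => i _; rewrite scaler_sumr.
  by apply: eq_bigr => j _; rewrite scalerA.
have [r r0 Fr] := Fsup c.
exists 2, (fun i => if i == ord0 then x0 else x0 + r *: \sum_i c i *: b i).
exists (fun i => if i == ord0 then 1 - r^-1 else r^-1).
split; first by move=> i; case: ifP.
  by rewrite !big_ord_recl big_ord0 /= addr0 subrK.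
rewrite !big_ord_recl big_ord0 /= addr0 scalerDr scalerA mulVf// scale1r.
by rewrite addrA -scalerDl subrK scale1r.
Qed.

Lemma lin_indep_neq0 d (b : 'I_d -> V) i : lin_indep b -> b i != 0.
Proof.
move=> /(_ (fun j => (j == i)%:R)) indb; apply/eqP => bi0.
have /indb /(_ i) /eqP : \sum_j (j == i)%:R *: b j = 0.
  by rewrite (bigD1 i)//= bi0 scaler0 add0r big1// => j /negbTE ->; rewrite scale0r.
by rewrite eqxx oner_eq0.
Qed.

End LinearForms.

Section SimplePolyhedron.
Variables (R : realType) (V : normedModType R) (q p D : nat).
Variables (h : V -> R) (g : 'I_q -> V -> R).
Hypothesis lin_h : linear_form h.
Hypothesis lin_g : forall k, linear_form (g k).

(** A slice [h = 1] of a homogeneous cone: all forms are linear without constant terms, and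
    displacements satisfy [h u = 0]. *)
Definition polyhedron : set V := [set v | h v = 1 /\ forall k, 0 <= g k v].

Definition tight (v : V) : {set 'I_q} := [set k | g k v == 0]%SET.

Definition directions (J : {set 'I_q}) : set V :=
  [set u | h u = 0 /\ forall k, k \in J -> g k u = 0].

(** Non-degeneracy as it is used at a point: [D] tight inequalities leave no direction, [D - 1]
    leave a line, and a further tight inequality is not constant on that line. Subsets [J] occur
    because a cell prescribes only some of the tight inequalities. *)
Definition simple_polyhedron := forall v, polyhedron v ->
  [/\ (#|tight v| <= D)%N,
      forall J : {set 'I_q}, J \subset tight v -> #|J| = D ->
        forall u, directions J u -> u = 0
    & forall J : {set 'I_q}, J \subset tight v -> #|J|.+1 = D ->
        exists d, [/\ d != 0, directions J d,
          forall u, directions J u -> exists c, u = c *: d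
          & forall k, k \in tight v -> k \notin J -> g k d != 0]].

Variables (phi : V -> 'rV[R]_p) (psi : 'rV[R]_p -> V).
Hypothesis phiK : cancel phi psi.
Hypothesis psiK : cancel psi phi.
Hypothesis lin_psi : linear psi.
Hypothesis pD : p = D.+1.
Hypothesis g_continuous : forall k, continuous (g k).

Lemma psi_sum (d : nat) (c : 'rV[R]_d) (M : 'M[R]_(d, p)) :
  psi (c *m M) = \sum_i c 0 i *: psi (row i M).
Proof.
pose F : {linear 'rV[R]_p -> V} :=
  HB.pack psi (GRing.isLinear.Build R 'rV[R]_p V *:%R psi lin_psi).
rewrite mulmx_sum_row -[psi]/(F : _ -> _) linear_sum /=.
by apply: eq_bigr => i _; rewrite -[psi]/(F : _ -> _) linearZ.
Qed.

Lemma psi_row (d : nat) (c : 'I_d -> R) (M : 'M[R]_(d, p)) :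
  \sum_i c i *: psi (row i M) = psi ((\row_i c i) *m M).
Proof. by rewrite psi_sum; apply: eq_bigr => i _; rewrite mxE. Qed.

Lemma psi0 : psi 0 = 0.
Proof. by have := lin_psi (-1) 0 0; rewrite scaler0 addr0 scaleN1r addNr. Qed.

(** The directions are the common kernel of [h] and the forms of [J], that is of [#|J| + 1]
    equations in dimension [D + 1]; rank-nullity gives the bound on [d]. *)
Lemma directions_basis (J : {set 'I_q}) : exists d (b : 'I_d -> V),
  [/\ lin_indep b, (D <= d + #|J|)%N
    & forall u, directions J u <-> exists c, u = \sum_i c i *: b i].
Proof.
pose F (j : 'I_(#|J|.+1)) := if unlift ord0 j is Some j' then g (enum_val j') else h.
have lin_F j : linear_form (F j) by rewrite /F; case: unlift.
pose M := \matrix_(i < p, j < #|J|.+1) F j (psi (row i 1%:M)).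
have FM u j : (phi u *m M) 0 j = F j u.
  rewrite -{2}(phiK u) -{2}(mulmx1 (phi u)) psi_sum linear_form_sum// mxE.
  by apply: eq_bigr => i _; rewrite linear_formZ// !mxE.
have dirE u : directions J u <-> phi u *m M = 0.
  split=> [[hu gu]|/matrixP FM0].
    apply/matrixP => i j; rewrite ord1 FM mxE /F.
    by case: unliftP => // j' _; rewrite gu// enum_valP.
  have F0 j : F j u = 0 by rewrite -FM FM0 mxE.
  split; first by have := F0 ord0; rewrite /F unlift_none.
  move=> k kJ; have := F0 (lift ord0 (enum_rank_in kJ k)).
  by rewrite /F liftK enum_rankK_in.
exists (\rank (kermx M)), (fun i => psi (row i (row_base (kermx M)))); split.
- move=> c; rewrite psi_row -psi0 => /(can_inj psiK).
  move/eqP; rewrite mulmx_free_eq0 ?row_base_free// => /eqP /rowP c0 i.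
  by have := c0 i; rewrite !mxE.
- by rewrite mxrank_ker; have := rank_leq_col M; lia.
- move=> u; rewrite dirE; split=> [/sub_kermxP|[c ->]].
    rewrite -(eq_row_base (kermx M)) => /submxP[c uc].
    by exists (c 0); rewrite -psi_sum -uc phiK.
  rewrite psi_row psiK; apply/sub_kermxP.
  by rewrite -(eq_row_base (kermx M)) submxMl.
Qed.

Lemma nontight_near v : polyhedron v -> exists2 e : R, 0 < e &
  forall y, ball v e y -> forall k, k \notin tight v -> 0 < g k y.
Proof.
move=> [_ g0].
have : \forall y \near v, forall k, k \notin tight v -> 0 < g k y.
  apply: filter_forall => k; case: (boolP (k \in tight v)) => kt; first by near=> y.
  have gk : 0 < g k v by rewrite lt_neqAle g0 andbT eq_sym; move: kt; rewrite inE.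
  have /cvgr_gt /(_ _ gk) := @g_continuous k v.
  by apply: filterS => y.
by move=> /nbhs_ballP[e /= e0 eP]; exists e.
Unshelve. all: by end_near. Qed.

(** Inequalities not tight at [v] stay strict nearby, so the face cut out by the tight ones contains
    all points near [v] along [directions (tight v)]. Its dimension is therefore [d], [v] is in its
    relative interior, and the count applies. *)
Lemma tight_directions v d (b : 'I_d -> V) : 
  Defs.nondegenerate polyhedron tight D -> polyhedron v -> lin_indep b ->
  (forall u, directions (tight v) u <-> exists c, u = \sum_i c i *: b i) ->
  (#|tight v| + d)%N = D.
Proof.
move=> nd Kv indb dirE.
pose F := [set y | polyhedron y /\ forall k, k \in tight v -> g k y = 0].
have [hv gv] := Kv.
have gv0 k : k \in tight v -> g k v = 0 by rewrite inE => /eqP.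
have Fv : F v by split.
have [e e0 eP] := nontight_near Kv.
have FP u : directions (tight v) u -> ball v e (v + u) -> F (v + u).
  move=> [hu gu] vu; split; last by move=> k kt; rewrite linear_formD// gv0// gu// addr0.
  split; first by rewrite linear_formD// hu addr0.
  move=> k; have [kt|kt] := boolP (k \in tight v); last exact/ltW/eP.
  by rewrite linear_formD// gv0// gu// addr0.
have hull : affine_hull F = [set v + \sum_i c i *: b i | c in [set: 'I_d -> R]].
  apply: affine_hull_span => //.
    move=> y [[hy _] gy]; have [|c yE] := (dirE (y - v)).1.
      split=> [|k kt]; rewrite -scaleN1r addrC ?lin_h ?lin_g ?hy ?hv ?gy ?gv0//; lra.
    by exists c; rewrite -yE addrC subrK.
  move=> c; set u := \sum_i _.
  have du : directions (tight v) u by apply/dirE; exists c.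
  (* This factor shrinks [u] to norm below [e]; the summand 1 covers [u = 0]. *)
  have r0 : 0 < e / (`|u| + 1) by rewrite divr_gt0// ltr_wpDl.
  exists (e / (`|u| + 1)); first by rewrite gt_eqF.
  apply: FP.
    have [hu gu] := du.
    by split=> [|k kt]; rewrite linear_formZ// ?hu ?gu// mulr0.
  rewrite -ball_normE /= opprD addrA subrr add0r normrN normrZ gtr0_norm//.
  by rewrite mulrAC ltr_pdivrMr ?ltr_wpDl// ltr_pM2l// ltrDl.
apply: (nd F) => //; first by apply: is_face_of_forms => // k y _ [_]; apply.
  by exists v, b.
split=> //; exists e => // y; rewrite hull => -[c _ <-] /FP; apply.
by apply/dirE; exists c.
Qed.

Lemma nondegenerate_simple : Defs.nondegenerate polyhedron tight D -> simple_polyhedron.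
Proof.
move=> nd v Kv.
have [d [b [indb _ dirE]]] := directions_basis (tight v).
have tD := tight_directions nd Kv indb dirE.
have full (J : {set 'I_q}) : J \subset tight v -> #|J| = D ->
    forall u, directions J u -> u = 0.
  move=> Jt JD u.
  have tJ : J = tight v by apply/eqP; rewrite eqEcard Jt JD -tD leq_addr.
  have d0 : d = 0%N by move: tD; rewrite -tJ JD; lia.
  subst d; rewrite tJ => /dirE[c ->]; by rewrite big_ord0.
split=> //; first by rewrite -tD leq_addr.
move=> J Jt JD.
have [d' [b' [indb' leD dirE']]] := directions_basis J.
(* Either [tight v] is [J] and its directions form a line, or it exceeds [J] by a single [k]; then
   [g k] is injective on the directions of [J], because [D] tight equations leave none, and these
   directions again form a line. *)
have key : #|tight v| = #|J| \/ #|tight v| = D.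
  by have := subset_leq_card Jt; lia.
have [tJ|tD'] := key.
  have tE : tight v = J by apply/eqP; rewrite eq_sym eqEcard Jt tJ leqnn.
  have d1 : d = 1%N by move: tD; rewrite tJ -JD; lia.
  subst d; exists (b ord0); split.
  - exact: lin_indep_neq0.
  - rewrite -tE; apply/dirE; exists (fun=> 1); by rewrite big_ord1 scale1r.
  - by move=> u; rewrite -tE => /dirE[c ->]; exists (c ord0); rewrite big_ord1.
  - by move=> k; rewrite tE => ->.
have d'0 : (0 < d')%N by lia.
pose d0 := b' (Ordinal d'0).
have d00 : d0 != 0 by exact: lin_indep_neq0.
have dirJ : directions J d0.
  apply/dirE'; exists (fun i => (i == Ordinal d'0)%:R).
  rewrite (bigD1 (Ordinal d'0))// eqxx scale1r big1 /= ?addr0// => i /negbTE ->.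
  by rewrite scale0r.
have tJ k : k \in tight v -> k \notin J -> tight v = k |: J.
  move=> kt kJ; apply/eqP; rewrite eq_sym eqEcard finset.subUset finset.sub1set kt Jt/=.
  by rewrite finset.cardsU1 kJ add1n JD tD'.
have dirU k u : k \in tight v -> k \notin J -> directions J u -> g k u = 0 -> u = 0.
  move=> kt kJ [hu gu] gk; apply: (full (tight v)) => //; split=> // k'.
  by rewrite (tJ k)// finset.in_setU1 => /orP[/eqP->//|/gu].
exists d0; split=> //; last first.
  by move=> k kt kJ; apply: contra d00 => /eqP /(dirU _ _ kt kJ dirJ)/eqP.
have [k kt kJ] : exists2 k, k \in tight v & k \notin J.
  have : ~~ (tight v \subset J) by apply/negP => /subset_leq_card; lia.
  by move=> /subsetPn.
have gk0 : g k d0 != 0 by apply: contra d00 => /eqP /(dirU _ _ kt kJ dirJ)/eqP.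
move=> u [hu gu]; exists (g k u / g k d0).
have [hd gd] := dirJ.
apply/eqP; rewrite -subr_eq0; apply/eqP; apply: (dirU k) => //.
  split=> [|k' k'J]; rewrite -scaleNr addrC.
    by rewrite lin_h hd hu mulr0 addr0.
  by rewrite lin_g (gd k')// (gu k')// mulr0 addr0.
by rewrite -scaleNr addrC lin_g mulNr divfK// addNr.
Qed.

End SimplePolyhedron.

(** * Cells in a product of simple polyhedra *)

Lemma has_dim1 (R : realType) (V : normedModType R) (F : set V) (a d : V) (r0 : R) :
  d != 0 -> r0 != 0 -> F a -> F (a + r0 *: d) ->
  (forall z, F z -> exists r, z = a + r *: d) -> has_dim F 1.
Proof.
move=> d0 r00 Fa Fb Fline; exists a, (fun=> d); split.
  move=> c; rewrite big_ord1 => /eqP; rewrite scaler_eq0 (negbTE d0) orbF => /eqP c0 i.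
  by rewrite ord1.
apply: affine_hull_span => //.
  by move=> z /Fline[r ->]; exists (fun=> r); rewrite big_ord1.
move=> c; rewrite big_ord1; have [->|c0] := eqVneq (c ord0) 0.
  by exists 1; rewrite ?oner_neq0// scale0r scaler0 addr0.
by exists (r0 / c ord0); rewrite ?mulf_neq0 ?invr_neq0// scalerA divfK.
Qed.

Section Product.
Variables (R : realType) (V1 V2 : normedModType R) (N D1 D2 : nat).
Variables (h1 : V1 -> R) (h2 : V2 -> R).
Variables (g1 : 'I_N -> V1 -> R) (g2 : 'I_N -> V2 -> R).
Hypothesis lin_h1 : linear_form h1.
Hypothesis lin_h2 : linear_form h2.
Hypothesis lin_g1 : forall k, linear_form (g1 k).
Hypothesis lin_g2 : forall k, linear_form (g2 k).
Hypothesis h1_continuous : continuous h1.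
Hypothesis h2_continuous : continuous h2.
Hypothesis g1_continuous : forall k, continuous (g1 k).
Hypothesis g2_continuous : forall k, continuous (g2 k).
Hypothesis simple1 : simple_polyhedron D1 h1 g1.
Hypothesis simple2 : simple_polyhedron D2 h2 g2.
Hypothesis dims : (D1 + D2 = N.+1)%N.

Let V : normedModType R := (V1 * V2)%type.
Let K : set V := polyhedron h1 g1 `*` polyhedron h2 g2.

Definition slack (b : bool) (k : 'I_N) (z : V1 * V2) : R :=
  if b then g1 k z.1 else g2 k z.2.

Lemma slack_linear b k (a : R) (u v : V) :
  slack b k (a *: u + v) = a * slack b k u + slack b k v.
Proof. by case: b; [exact: lin_g1|exact: lin_g2]. Qed.

Lemma slack_shift b k (p d : V) r :
  slack b k (p + r *: d) = slack b k p + r * slack b k d.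
Proof. by rewrite addrC slack_linear addrC. Qed.

Lemma slack_scale b k (d : V) r : slack b k (r *: d) = r * slack b k d.
Proof. by have := @linear_formZ R V (slack b k) r d (slack_linear b k). Qed.

Lemma slack_continuous b k : continuous (slack b k : V -> R).
Proof.
move=> z; case: b; rewrite /slack.
  by apply: (continuous_comp (f := fst)); [exact: cvg_fst|exact: g1_continuous].
by apply: (continuous_comp (f := snd)); [exact: cvg_snd|exact: g2_continuous].
Qed.

Lemma polyhedron_slack_ge0 b k (z : V) : K z -> 0 <= slack b k z.
Proof. by move=> [[_ ge1] [_ ge2]]; case: b; [exact: ge1|exact: ge2]. Qed.

Definition cell (s : {ffun 'I_N -> bool}) : set V :=
  [set z | K z /\ forall k, slack (s k) k z = 0].

Definition cell_direction (s : {ffun 'I_N -> bool}) : set V :=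
  [set u | [/\ h1 u.1 = 0, h2 u.2 = 0 & forall k, slack (s k) k u = 0]].

Definition recession (s : {ffun 'I_N -> bool}) : set V :=
  [set u | cell_direction s u /\ forall k, 0 <= slack (~~ s k) k u].

Definition cell_ends (s : {ffun 'I_N -> bool}) : set V :=
  [set z | cell s z /\ exists k, slack (~~ s k) k z = 0].

Lemma cell_closed s : closed (cell s).
Proof.
have -> : cell s = [set z | [/\ h1 z.1 = 1, h2 z.2 = 1,
    forall b k, 0 <= slack b k z & forall k, slack (s k) k z = 0]].
  apply/seteqP; split=> z.
    by move=> [Kz sz]; split=> //;
      [case: Kz => -[]|case: Kz => _ []|move=> b k; exact: polyhedron_slack_ge0].
  move=> [h1z h2z s0 sz]; split=> //; split; split=> // k; first exact: (s0 true).
  exact: (s0 false).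
have -> : [set z | [/\ h1 z.1 = 1, h2 z.2 = 1,
    forall b k, 0 <= slack b k z & forall k, slack (s k) k z = 0]] =
   (h1 \o fst) @^-1` [set 1] `&` ((h2 \o snd) @^-1` [set 1] `&`
   ((\bigcap_(b in setT) \bigcap_(k in setT) (slack b k @^-1` [set r | 0 <= r])) `&`
    (\bigcap_(k in setT) (slack (s k) k @^-1` [set 0])))).
  apply/seteqP; split=> z.
    by move=> [? ? ge e]; do !split=> //; [move=> b _ k _; exact: ge|move=> k _; exact: e].
  by move=> [? [? [ge e]]]; split=> // [b k|k]; [exact: (ge b I k I)|exact: (e k I)].
apply: closedI; last apply: closedI; last apply: closedI.
- apply: closed_comp; last exact: closed_eq.
  by move=> z _; apply: continuous_comp; [exact: cvg_fst|exact: h1_continuous].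
- apply: closed_comp; last exact: closed_eq.
  by move=> z _; apply: continuous_comp; [exact: cvg_snd|exact: h2_continuous].
- apply: closed_bigI => b _; apply: closed_bigI => k _.
  by apply: closed_comp; [move=> z _; exact: slack_continuous|exact: closed_ge].
- apply: closed_bigI => k _.
  by apply: closed_comp; [move=> z _; exact: slack_continuous|exact: closed_eq].
Qed.

(** The [N = D1 + D2 - 1] labels split into at most [D1] chosen in the first factor and at most [D2]
    in the second, so one side is full and the other short by one. The full side admits no direction
    and no further tight inequality; the other admits a line. An edge thus moves in one factor
    only. *)
Lemma cell_line s z : cell s z -> exists d, [/\ d != 0, cell_direction s d,
  forall u, cell_direction s u -> exists c, u = c *: d
  & forall k, slack (~~ s k) k z = 0 -> slack (~~ s k) k d != 0].
Proof.
move=> [[K1 K2] sz].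
pose J := [set k | s k]%SET.
have JE k : (k \in J) = s k by rewrite inE.
have JCE k : (k \in ~: J) = ~~ s k by rewrite finset.in_setC JE.
have sub1 : J \subset tight g1 z.1.
  by apply/fintype.subsetP => k; rewrite JE inE => sk; have := sz k; rewrite sk => /eqP.
have sub2 : ~: J \subset tight g2 z.2.
  by apply/fintype.subsetP => k; rewrite JCE inE => /negbTE sk;
     have := sz k; rewrite sk => /eqP.
have cJ := cardsC J; rewrite card_ord in cJ.
have [le1 full1 line1] := simple1 K1; have [le2 full2 line2] := simple2 K2.
have l1 : (#|J| <= D1)%N := leq_trans (subset_leq_card sub1) le1.
have l2 : (#|~: J| <= D2)%N := leq_trans (subset_leq_card sub2) le2.
have dir1 u : cell_direction s u -> directions h1 g1 J u.1.
  by move=> [hu _ su]; split=> // k; rewrite JE => sk; have := su k; rewrite sk.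
have dir2 u : cell_direction s u -> directions h2 g2 (~: J) u.2.
  by move=> [_ hu su]; split=> // k; rewrite JCE => /negbTE sk; have := su k; rewrite sk.
have [[c1 c2]|[c1 c2]] : (#|J| = D1 /\ #|~: J|.+1 = D2) \/ (#|J|.+1 = D1 /\ #|~: J| = D2).
  by move: cJ l1 l2 dims; clear; lia.
- have [d [d0 [hd gd] dspan dtight]] := line2 _ sub2 c2.
  have tE : tight g1 z.1 = J by apply/eqP; rewrite eq_sym eqEcard sub1 c1.
  exists (0, d); split.
  + by apply: contra d0 => /eqP[->].
  + split=> //=; first exact: linear_form0.
    move=> k; rewrite /slack; case: ifPn => sk /=; first exact: linear_form0.
    by apply: gd; rewrite JCE.
  + move=> u du; have [c uc] := dspan _ (dir2 _ du); exists c.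
    have u1 := full1 _ sub1 c1 _ (dir1 _ du).
    by rewrite [u]surjective_pairing uc u1; congr pair; rewrite /= scaler0.
  + move=> k; rewrite /slack; case: ifPn => sk.
      move=> /eqP kt; exfalso; have : k \in tight g1 z.1 by rewrite inE.
      by rewrite tE JE; exact/negP.
    by move=> /eqP kt; apply: dtight; rewrite ?inE ?negbK // -(negbK (s k)).
- have [d [d0 [hd gd] dspan dtight]] := line1 _ sub1 c1.
  have tE : tight g2 z.2 = ~: J by apply/eqP; rewrite eq_sym eqEcard sub2 c2.
  exists (d, 0); split.
  + by apply: contra d0 => /eqP[->].
  + split=> //=; first exact: linear_form0.
    move=> k; rewrite /slack; case: ifPn => sk /=; last exact: linear_form0.
    by apply: gd; rewrite JE.
  + move=> u du; have [c uc] := dspan _ (dir1 _ du); exists c.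
    have u2 := full2 _ sub2 c2 _ (dir2 _ du).
    by rewrite [u]surjective_pairing uc u2; congr pair; rewrite /= scaler0.
  + move=> k; rewrite /slack; case: ifPn => sk.
      by move=> /eqP kt; apply: dtight; rewrite ?inE.
    move=> /eqP kt; exfalso; have : k \in tight g2 z.2 by rewrite inE.
    by rewrite tE JCE; exact/negP.
Qed.

(** Every label is tight in at least one factor, so those tight in both number at most
    [D1 + D2 - N = 1]. *)
Lemma tie_unique s z k k' : cell s z -> slack (~~ s k) k z = 0 ->
  slack (~~ s k') k' z = 0 -> k = k'.
Proof.
move=> [[K1 K2] sz].
have le1 : (#|tight g1 z.1| <= D1)%N by have [] := simple1 K1.
have le2 : (#|tight g2 z.2| <= D2)%N by have [] := simple2 K2.
have cU : tight g1 z.1 :|: tight g2 z.2 = [set: 'I_N]%SET.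
  apply/setP => j; rewrite !inE; have := sz j; rewrite /slack.
  by case: (s j) => ->; rewrite eqxx ?orbT.
have := cardsUI (tight g1 z.1) (tight g2 z.2); rewrite cU cardsT card_ord => cI.
have tie j : slack (~~ s j) j z = 0 -> j \in tight g1 z.1 :&: tight g2 z.2.
  rewrite !inE; have := sz j; rewrite /slack.
  by case: (s j) => /= -> ->; rewrite !eqxx.
have /card_le1_eqP : (#|tight g1 z.1 :&: tight g2 z.2| <= 1)%N.
  by move: cI le1 le2 dims; clear; lia.
by move=> uniq /tie kt /tie k't; exact: uniq.
Qed.

Lemma tie_direction s z k u : cell s z -> slack (~~ s k) k z = 0 ->
  cell_direction s u -> u != 0 -> slack (~~ s k) k u != 0.
Proof.
move=> /cell_line[d [_ _ span dtie]] /dtie kd /span[c ->].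
rewrite scaler_eq0 negb_or slack_scale => /andP[c0 _].
by rewrite mulf_neq0.
Qed.

Lemma cell_shift s (p d : V) r : cell s p -> cell_direction s d ->
  cell s (p + r *: d) <->
  forall k, 0 <= slack (~~ s k) k p + r * slack (~~ s k) k d.
Proof.
move=> [Kp sp] [hd1 hd2 sd]; split=> [[Kz _] k|ge].
  by rewrite -slack_shift; exact: polyhedron_slack_ge0.
have s0 k : slack (s k) k (p + r *: d) = 0 by rewrite slack_shift sp sd mulr0 addr0.
have all_ge b k : 0 <= slack b k (p + r *: d).
  have [->|/negPf bk] := eqVneq b (s k); first by rewrite s0.
  have -> : b = ~~ s k by move: bk; case: b; case: (s k).
  by rewrite slack_shift.
split=> //; move: Kp => [[hp1 _] [hp2 _]]; split; split.
- by rewrite addrC lin_h1 hd1 mulr0 add0r.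
- by move=> k; exact: (all_ge true k).
- by rewrite addrC lin_h2 hd2 mulr0 add0r.
- by move=> k; exact: (all_ge false k).
Qed.

Lemma cell_sub s (p z : V) : cell s p -> cell s z -> cell_direction s (z - p).
Proof.
move=> [[[hp1 _] [hp2 _]] sp] [[[hz1 _] [hz2 _]] sz].
rewrite -scaleN1r addrC; split=> [||k].
- by rewrite lin_h1 hp1 hz1 mulr1 addNr.
- by rewrite lin_h2 hp2 hz2 mulr1 addNr.
- by rewrite slack_linear sp sz mulr0 addr0.
Qed.

(** The minimum ratio test: among the slacks that decrease along [d], the first to vanish stops the
    motion. *)
Lemma cell_blocked s (p d : V) : cell s p -> cell_direction s d ->
  ~ recession s d -> exists r k, [/\ 0 <= r, cell s (p + r *: d),
    slack (~~ s k) k (p + r *: d) = 0 & slack (~~ s k) k d < 0].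
Proof.
move=> cp cd nrec.
have [k0 k0d] : exists k0, slack (~~ s k0) k0 d < 0.
  apply: contrapT => nex; apply: nrec; split=> // k; rewrite leNgt; apply/negP => lt0.
  by apply: nex; exists k.
pose F k := slack (~~ s k) k p / - slack (~~ s k) k d.
have [k kd kmin] := Order.TotalTheory.arg_minP F (P := fun k => slack (~~ s k) k d < 0) k0d.
have ge0 j : 0 <= slack (~~ s j) j p by apply: polyhedron_slack_ge0; case: cp.
exists (F k), k; split=> //.
- by rewrite divr_ge0// oppr_ge0 ltW.
- apply/cell_shift => // j; have [jd|jd] := ltP (slack (~~ s j) j d) 0.
    have := kmin j jd; rewrite {2}/F ler_pdivlMr ?oppr_gt0//; lra.
  by rewrite addr_ge0// mulr_ge0// divr_ge0// oppr_ge0 ltW.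
- by rewrite slack_shift /F invrN mulrN mulNr divfK ?addrN// lt_eqF.
Qed.

Hypothesis pointed : forall s (u : V), recession s u -> recession s (- u) -> u = 0.

(** By [pointed], [d] can be oriented so that [- d] is not a recession direction. Moving back stops
    at an end [a], and the slack that vanishes there grows along [d], so the cell lies on the
    forward side. Moving forward either never stops or stops at a second end. *)
Lemma cell_shape s : cell s !=set0 ->
  (exists a b, [/\ a != b, cell s = closed_segment a b,
     cell_ends s = [set a; b] & forall u, recession s u -> u = 0]) \/
  (exists a d, [/\ d != 0, cell s = halfline a d, cell_ends s = [set a]
     & recession s d]).
Proof.
move=> [p cp]; have [d' [d'0 cd' span' _]] := cell_line cp.
have [d [d0 cd span nrec]] : exists d, [/\ d != 0, cell_direction s d,
    forall u, cell_direction s u -> exists c, u = c *: d & ~ recession s (- d)].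
  have [rec|nrec] := pselect (recession s (- d')); last by exists d'.
  have [cNd' _] := rec.
  exists (- d'); split=> //; first by rewrite oppr_eq0.
    by move=> u /span'[c ->]; exists (- c); rewrite scalerN scaleNr opprK.
  move=> rec'; move/eqP: d'0; apply; apply: oppr_inj; rewrite oppr0.
  exact: pointed rec rec'.
have cNd : cell_direction s (- d).
  have [hd1 hd2 sd] := cd; rewrite -scaleN1r.
  split=> [||k]; [by rewrite linear_formZ// hd1 mulr0|by rewrite linear_formZ// hd2 mulr0|].
  by rewrite slack_scale sd mulr0.
have [ra [ka [_ ca ka0 kad]]] := cell_blocked cp cNd nrec.
set a := p + ra *: - d in ca ka0.
have {}kad : 0 < slack (~~ s ka) ka d.
  by move: kad; rewrite -scaleN1r slack_scale mulN1r oppr_lt0.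
have line z : cell s z -> exists2 r, 0 <= r & z = a + r *: d.
  move=> cz; have [r zE] := span _ (cell_sub ca cz).
  have {}zE : z = a + r *: d by rewrite -zE addrC subrK.
  exists r => //; have : 0 <= slack (~~ s ka) ka z by apply: polyhedron_slack_ge0; case: cz.
  by rewrite zE slack_shift ka0 add0r pmulr_lge0.
have a_ge k : 0 <= slack (~~ s k) k a by apply: polyhedron_slack_ge0; case: ca.
have aend : cell_ends s a by split=> //; exists ka.
(* A slack that grows along [d] is nonnegative at [a], so beyond [a] it cannot vanish. *)
have tie_sign r k : cell s (a + r *: d) -> slack (~~ s k) k (a + r *: d) = 0 ->
    0 < slack (~~ s k) k d -> 0 <= r -> r = 0.
  move=> cz; rewrite slack_shift => e kd r0.
  apply/eqP; rewrite eq_le r0 andbT -(pmulr_lle0 _ kd); have := a_ge k; lra.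
have [rec|nrec'] := pselect (recession s d).
  right; exists a, d; split=> //.
    apply/seteqP; split=> [z /line[r r0 ->]|_ [r /= r0 <-]]; first by exists r.
    by apply/cell_shift => // k; rewrite addr_ge0// mulr_ge0//; case: rec.
  apply/seteqP; split=> [z [cz [k kz]]|_ ->//]; have [r r0 zE] := line z cz.
  have kd : 0 < slack (~~ s k) k d.
    have [_ /(_ k)] := rec; rewrite le_eqVlt => /orP[/eqP e|//].
    by have := tie_direction cz kz cd d0; rewrite -e eqxx.
  by rewrite zE in cz kz *; rewrite (tie_sign r k)//= scale0r addr0.
have [rb [kb [rb0 cb kb0 kbd]]] := cell_blocked ca cd nrec'.
set b := a + rb *: d in cb kb0.
(* At [a] only [ka] is tight twice, and its slack grows along [d], while the blocking slack [kb]
   decreases; so the move has positive length. *)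
have rb_gt0 : 0 < rb.
  rewrite lt_neqAle rb0 andbT eq_sym; apply/eqP => rb00.
  rewrite /b rb00 scale0r addr0 in kb0.
  by have kk := tie_unique ca ka0 kb0; move: kbd; rewrite -kk; lra.
have ba : b - a = rb *: d by rewrite /b addrAC subrr add0r.
left; exists a, b; split.
- by apply/eqP => ab; move/eqP: ba; rewrite ab subrr eq_sym scaler_eq0 (negbTE d0) orbF gt_eqF.
- apply/seteqP; split=> [z cz|_ [t /= /andP[t0 t1] <-]].
    have [r r0 zE] := line z cz.
    have : 0 <= slack (~~ s kb) kb z by apply: polyhedron_slack_ge0; case: cz.
    have : slack (~~ s kb) kb z = (r - rb) * slack (~~ s kb) kb d.
      by move: kb0; rewrite zE /b !slack_shift; lra.
    move=> -> ge; have rrb : r <= rb by nra.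
    exists (r / rb); first by rewrite /= divr_ge0// ler_pdivrMr// mul1r.
    by rewrite ba scalerA divfK ?gt_eqF.
  rewrite ba scalerA; apply/cell_shift => // k.
  have bk : 0 <= slack (~~ s k) k b by apply: polyhedron_slack_ge0; case: cb.
  rewrite /b slack_shift in bk; have := a_ge k.
  move: (slack (~~ s k) k a) (slack (~~ s k) k d) bk => x y bk x0.
  have -> : x + t * rb * y = (1 - t) * x + t * (x + rb * y) by ring.
  by rewrite addr_ge0// mulr_ge0//; lra.
- apply/seteqP; split=> [z [cz [k kz]]|_ [->//|->]]; last by split=> //; exists kb.
  have [r r0 zE] := line z cz; have := tie_direction cz kz cd d0.
  rewrite neq_lt => /orP[kd|kd]; last first.
    by left; rewrite zE in cz kz *; rewrite (tie_sign r k)//= scale0r addr0.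
  right; rewrite zE /b /=; congr (_ + _ *: _).
  have bk : 0 <= slack (~~ s k) k b by apply: polyhedron_slack_ge0; case: cb.
  have : 0 <= slack (~~ s kb) kb z by apply: polyhedron_slack_ge0; case: cz.
  have : slack (~~ s kb) kb z = (r - rb) * slack (~~ s kb) kb d.
    by move: kb0; rewrite zE /b !slack_shift; lra.
  move=> -> ge; have rrb : r <= rb by nra.
  by move: kz bk; rewrite zE /b !slack_shift => e bk; apply/eqP; rewrite eq_le rrb /=; nra.
- move=> u [/span[c ->] ge].
  have := ge ka; have := ge kb; rewrite !slack_scale => geb gea.
  have -> : c = 0 by nra.
  by rewrite scale0r.
Qed.

Lemma cell_edge s : cell s !=set0 -> is_edge K (cell s).
Proof.
move=> s0; split.
  have -> : cell s = [set v : V | K v /\ forall k, predT k -> slack (s k) k v = 0].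
    by apply/seteqP; split=> v [Kv sv]; split=> // k *; exact: sv.
  apply: (@is_face_of_forms R V K 'I_N (fun k => slack (s k) k) predT) => /=.
    by move=> k a u v; exact: slack_linear.
  by move=> k v _; exact: polyhedron_slack_ge0.
have [[a [b [ab cE _ _]]]|[a [d [d0 cE _ _]]]] := cell_shape s0.
  have ba : b - a != 0 by rewrite subr_eq0 eq_sym.
  apply: (has_dim1 (a := a) ba (oner_neq0 R)); rewrite cE; first exact: closed_segment_l.
    by rewrite scale1r addrC subrK; exact: closed_segment_r.
  by move=> _ [r _ <-]; exists r.
apply: (has_dim1 (a := a) d0 (oner_neq0 R)); rewrite cE.
    by exists 0 => //=; rewrite scale0r addr0.
  by exists 1; rewrite /= ?ler01.
by move=> _ [r _ <-]; exists r.
Qed.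

Theorem product_decomposition r1 r2 :
  r1 != r2 -> cell r1 !=set0 -> cell r2 !=set0 ->
  (exists2 u, u != 0 & recession r1 u) -> (exists2 u, u != 0 & recession r2 u) ->
  (forall s u, cell s !=set0 -> recession s u -> u != 0 -> s = r1 \/ s = r2) ->
  let F := [set z | K z /\ forall k, slack true k z = 0 \/ slack false k z = 0] in
  exists (Pth : set V) (k : nat) (Cyc : 'I_k -> set V),
    F = Pth `|` \bigcup_i Cyc i /\
    (forall i, Pth `&` Cyc i = set0) /\
    (forall i j, i != j -> Cyc i `&` Cyc j = set0) /\
    is_component F Pth /\
    (forall i, is_component F (Cyc i)) /\
    is_path K Pth /\
    (forall i, is_cycle K (Cyc i)).
Proof.
move=> r12 c1 c2 rec1 rec2 rec_only F.
pose T := {s : {ffun 'I_N -> bool} | `[< cell s !=set0 >]}.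
have cellT (s : T) : cell (val s) !=set0 by apply/asboolP; exact: valP s.
pose s1 : T := exist _ r1 (asboolT c1).
pose s2 : T := exist _ r2 (asboolT c2).
pose ray (s : T) := (s == s1) || (s == s2).
have -> : F = \bigcup_(s : T) cell (val s).
  apply/seteqP; split=> z.
    move=> [Kz tz]; pose s := [ffun k => slack true k z == 0].
    have cz : cell s z.
      split=> // k; rewrite ffunE; case: eqP => // nz.
      by have [] := tz k.
    have c0 : `[< cell s !=set0 >] by apply/asboolP; exists z.
    by exists (exist _ s c0).
  move=> [s _ [Kz sz]]; split=> // k; have := sz k.
  by case: (val s k); [left|right].
apply: (@cover_decomposition R V K T (fun s => cell (val s))
  (fun s => cell_ends (val s)) ray _ _ _ _ _ _ _ s1 s2) => //.
- by move=> s; exact: cell_closed.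
- by move=> s; exact: cell_edge.
- move=> s; rewrite negb_or => /andP[ss1 ss2].
  have [[a [b [ab cE eE _]]]|[a [d [d0 cE _ rec]]]] := cell_shape (cellT s).
    by exists a, b.
  have [e|e] := rec_only _ _ (cellT s) rec d0.
    by case/negP: ss1; apply/eqP/val_inj.
  by case/negP: ss2; apply/eqP/val_inj.
- move=> s sr.
  have [u u0 rec] : exists2 u, u != 0 & recession (val s) u.
    by move: sr => /orP[]/eqP ->.
  have [[a [b [_ _ _ norec]]]|[a [d [d0 cE eE _]]]] := cell_shape (cellT s).
    by move/eqP: u0; case; exact: norec.
  by exists a, d.
- move=> s t z st csz ctz; split=> //.
  have [k kst] : exists k, val s k != val t k.
    apply: contrapT => nk; move/eqP: st; apply; apply/val_inj/ffunP => k.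
    by apply: contrapT => /eqP kst; apply: nk; exists k.
  exists k; have [_ /(_ k)] := ctz.
  by move: kst; case: (val s k); case: (val t k).
- move=> s z [cz [k kz]].
  pose t := [ffun j => if j == k then ~~ val s j else val s j].
  have tz : cell t z.
    have [Kz sz] := cz; split=> // j; rewrite ffunE.
    by case: eqP => [->|_]; [exact: kz|exact: sz].
  have t0 : `[< cell t !=set0 >] by apply/asboolP; exists z.
  exists (exist _ t t0 : T) => //; apply/eqP => /(congr1 val) /= /ffunP /(_ k).
  by rewrite ffunE eqxx; case: (val s k).
- move=> s t w z st sz tz wz.
  have flip (x y : T) k : cell (val x) z -> cell (val y) z ->
      val x k != val y k -> slack (~~ val x k) k z = 0.
    move=> _ [_ /(_ k)]; by case: (val x k); case: (val y k).
  have [k kst] : exists k, val s k != val t k.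
    apply: contrapT => nk; move/eqP: st; apply; apply/val_inj/ffunP => k.
    by apply: contrapT => /eqP kst; apply: nk; exists k.
  have kz := flip _ _ _ sz tz kst.
  (* A cell through [z] can differ from [s] only at a label tight twice, hence only at [k]; one bit
     leaves two cells. *)
  have same (x : T) : cell (val x) z -> forall j, j != k -> val x j = val s j.
    move=> xz j jk; apply: contrapT => /eqP; rewrite eq_sym => jx.
    have jz := flip _ _ _ sz xz jx.
    by move/eqP: jk; apply; exact: tie_unique sz jz kz.
  have [e|ne] := eqVneq (val w k) (val s k).
    left; apply/val_inj/ffunP => j; have [->//|jk] := eqVneq j k.
    exact: same.
  right; apply/val_inj/ffunP => j; have [->|jk] := eqVneq j k.
    by move: kst ne; case: (val s k); case: (val t k); case: (val w k).
  by rewrite !same.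
Qed.

End Product.

(** * The polyhedra P and Q' *)

Lemma sum_continuous (R : realType) (T : topologicalType) (I : finType)
    (F : I -> T -> R) :
  (forall i, continuous (F i)) -> continuous (fun x => \sum_i F i x).
Proof.
move=> cF x; apply: (@cvg_big R I +%R 0 predT _ T (nbhs x)) => [|i _].
  exact: add_continuous.
exact: cF.
Qed.

Section Bimatrix.
Variables (R : realType) (m n : nat) (A C : 'M[R]_(m, n)) (beta : 'cV[R]_n).

Definition massP (v : Pspace R n) : R := \sum_j v.1 j 0.
Definition massQ (w : Qspace R m) : R := \sum_i w.1.1 i 0.

Definition slackP (k : 'I_(m + n)) (v : Pspace R n) : R :=
  match fintype.split k with
  | inl i => v.2 - (A *m v.1) i 0
  | inr j => v.1 j 0
  end.

Definition slackQ (k : 'I_(m + n)) (w : Qspace R m) : R :=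
  match fintype.split k with
  | inl i => w.1.1 i 0
  | inr j => w.2 - ((w.1.1^T *m C) 0 j + beta j 0 * w.1.2)
  end.

Lemma split_lshift (i : 'I_m) : fintype.split (lshift n i) = inl i.
Proof. exact: (unsplitK (inl i)). Qed.

Lemma split_rshift (j : 'I_n) : fintype.split (rshift m j) = inr j.
Proof. exact: (unsplitK (inr j)). Qed.

Lemma forall_label (P : 'I_(m + n) -> Prop) :
  (forall i, P (lshift n i)) -> (forall j, P (rshift m j)) -> forall k, P k.
Proof. by move=> Pl Pr k; rewrite -(splitK k); case: (fintype.split k). Qed.

Lemma polyhedronPE : polyhedronP A = polyhedron massP slackP.
Proof.
apply/seteqP; split=> [[y p] [Ay y0 y1]|[y p] [y1 s0]].
  split=> //; apply: forall_label => [i|j]; rewrite /slackP ?split_lshift ?split_rshift//=.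
  by have := Ay i; lra.
split=> //.
- by move=> i; have := s0 (lshift n i); rewrite /slackP split_lshift /=; lra.
- by move=> j; have := s0 (rshift m j); rewrite /slackP split_rshift.
Qed.

Lemma polyhedronQE : polyhedronQ C beta = polyhedron massQ slackQ.
Proof.
apply/seteqP; split=> [[[x l] p] [x0 xC x1]|[[x l] p] [x1 s0]].
  split=> //; apply: forall_label => [i|j]; rewrite /slackQ ?split_lshift ?split_rshift//=.
  by have := xC j; lra.
split=> //.
- by move=> i; have := s0 (lshift n i); rewrite /slackQ split_lshift.
- by move=> j; have := s0 (rshift m j); rewrite /slackQ split_rshift /=; lra.
Qed.

Lemma labelPE : labelP A = tight slackP.
Proof.
apply/funext => -[y p]; apply/setP => k; rewrite !inE /slackP /=.
by case: (fintype.split k) => i //; rewrite -oppr_eq0 opprB.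
Qed.

Lemma labelQE : labelQ C beta = tight slackQ.
Proof.
apply/funext => -[[x l] p]; apply/setP => k; rewrite !inE /slackQ /=.
by case: (fintype.split k) => i //; rewrite -oppr_eq0 opprB.
Qed.

Lemma linear_massP : linear_form massP.
Proof.
move=> a u v; rewrite /massP mulr_sumr -big_split /=; apply: eq_bigr => j _.
by rewrite !mxE.
Qed.

Lemma linear_massQ : linear_form massQ.
Proof.
move=> a u v; rewrite /massQ mulr_sumr -big_split /=; apply: eq_bigr => j _.
by rewrite !mxE.
Qed.

Lemma linear_slackP k : linear_form (slackP k).
Proof.
move=> a u v; rewrite /slackP; case: (fintype.split k) => i /=; last by rewrite !mxE.
have -> : (A *m (a *: u.1 + v.1)) i 0 = a * (A *m u.1) i 0 + (A *m v.1) i 0.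
  by rewrite mulmxDr -scalemxAr mxE [X in X + _]mxE.
by rewrite /GRing.scale /=; ring.
Qed.

Lemma linear_slackQ k : linear_form (slackQ k).
Proof.
move=> a u v; rewrite /slackQ; case: (fintype.split k) => i /=; first by rewrite !mxE.
have -> : ((a *: u.1.1 + v.1.1)^T *m C) 0 i =
    a * (u.1.1^T *m C) 0 i + (v.1.1^T *m C) 0 i.
  by rewrite linearP mulmxDl -scalemxAl mxE [X in X + _]mxE.
by rewrite /GRing.scale /=; ring.
Qed.

Lemma coord_P_continuous (j : 'I_n) : continuous (fun v : Pspace R n => v.1 j 0).
Proof.
move=> v; apply: (continuous_comp (f := fst) (g := fun y : 'cV[R]_n => y j 0)).
  exact: cvg_fst.
exact: coord_continuous.
Qed.

Lemma coord_Q_continuous (i : 'I_m) : continuous (fun w : Qspace R m => w.1.1 i 0).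
Proof.
move=> w; apply: (continuous_comp (f := fst) (g := fun u : 'cV[R]_m * R => u.1 i 0)).
  exact: cvg_fst.
apply: (continuous_comp (f := fst) (g := fun y : 'cV[R]_m => y i 0)).
  exact: cvg_fst.
exact: coord_continuous.
Qed.

Lemma massP_continuous : continuous massP.
Proof. by apply: sum_continuous => j; exact: coord_P_continuous. Qed.

Lemma massQ_continuous : continuous massQ.
Proof. by apply: sum_continuous => j; exact: coord_Q_continuous. Qed.

Lemma slackP_continuous k : continuous (slackP k).
Proof.
rewrite /slackP; case: (fintype.split k) => i; last exact: coord_P_continuous.
have -> : (fun v : Pspace R n => v.2 - (A *m v.1) i 0) =
    (fun v => v.2 - \sum_j A i j * v.1 j 0).
  by apply/funext => v; rewrite mxE.
move=> v; apply: cvgB; first exact: cvg_snd.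
apply: sum_continuous => j w.
by apply: cvgMl_tmp; exact: coord_P_continuous.
Qed.

Lemma slackQ_continuous k : continuous (slackQ k).
Proof.
rewrite /slackQ; case: (fintype.split k) => i; first exact: coord_Q_continuous.
have -> : (fun w : Qspace R m => w.2 - ((w.1.1^T *m C) 0 i + beta i 0 * w.1.2)) =
    (fun w => w.2 - (\sum_j w.1.1 j 0 * C j i + beta i 0 * w.1.2)).
  by apply/funext => v; rewrite !mxE; under eq_bigr do rewrite mxE.
move=> v; apply: cvgB; first exact: cvg_snd.
apply: cvgD.
  apply: sum_continuous => j w.
  by apply: cvgMr_tmp; exact: coord_Q_continuous.
apply: cvgMl_tmp.
apply: (continuous_comp (f := fst) (g := snd)); first exact: cvg_fst.
exact: cvg_snd.
Qed.

Lemma simpleP : nondegenerateP A -> simple_polyhedron n massP slackP.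
Proof.
rewrite /nondegenerateP polyhedronPE labelPE.
pose phi (v : Pspace R n) : 'rV[R]_(n + 1) := row_mx v.1^T v.2%:M.
pose psi (r : 'rV[R]_(n + 1)) : Pspace R n := ((lsubmx r)^T, rsubmx r 0 0).
apply: (@nondegenerate_simple _ _ _ _ _ _ _ linear_massP linear_slackP phi psi).
- by move=> [y p]; rewrite /phi /psi row_mxKl row_mxKr trmxK mxE eqxx mulr1n.
- by move=> r; rewrite /phi /psi /= trmxK -mx11_scalar hsubmxK.
- by move=> a u v; rewrite /psi !linearP /= !mxE.
- exact: addn1.
- exact: slackP_continuous.
Qed.

Lemma simpleQ : Defs.nondegenerate (polyhedronQ C beta) (labelQ C beta) m.+1 ->
  simple_polyhedron m.+1 massQ slackQ.
Proof.
rewrite polyhedronQE labelQE.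
pose phi (w : Qspace R m) : 'rV[R]_(m + 1 + 1) :=
  row_mx (row_mx w.1.1^T w.1.2%:M) w.2%:M.
pose psi (r : 'rV[R]_(m + 1 + 1)) : Qspace R m :=
  ((lsubmx (lsubmx r))^T, rsubmx (lsubmx r) 0 0, rsubmx r 0 0).
apply: (@nondegenerate_simple _ _ _ _ _ _ _ linear_massQ linear_slackQ phi psi).
- move=> [[x l] p]; rewrite /phi /psi !row_mxKl !row_mxKr trmxK.
  by rewrite ![_%:M 0 0]mxE eqxx !mulr1n.
- by move=> r; rewrite /phi /psi /= trmxK -!mx11_scalar !hsubmxK.
- by move=> a u v; rewrite /psi !linearP /= !mxE.
- by rewrite !addn1.
- exact: slackQ_continuous.
Qed.
End Bimatrix.

(** * Recession directions and the two half-lines *)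

Section Rays.
Variables (R : realType) (m n : nat) (A C : 'M[R]_(m, n)) (beta : 'cV[R]_n).
Hypothesis ndP : nondegenerateP A.
Variables (js jl : 'I_n).
Hypothesis js_min : forall j, j != js -> beta js 0 < beta j 0.
Hypothesis jl_max : forall j, j != jl -> beta j 0 < beta jl 0.
Hypothesis jsl : js != jl.
Variable best : 'I_n -> 'I_m.
Hypothesis best_max : forall j i, A i j <= A (best j) j.

Local Notation gP := (slackP A).
Local Notation gQ := (slackQ C beta).
Local Notation hP := (@massP R n).
Local Notation hQ := (@massQ R m).
Local Notation sl := (slack gP gQ).
Local Notation cl := (cell hP hQ gP gQ).
Local Notation recc := (recession hP hQ gP gQ).

Lemma slackP_l z i : sl true (lshift n i) z = z.1.2 - (A *m z.1.1) i 0.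
Proof. by rewrite /slack /slackP split_lshift. Qed.

Lemma slackP_r z j : sl true (rshift m j) z = z.1.1 j 0.
Proof. by rewrite /slack /slackP split_rshift. Qed.

Lemma slackQ_l z i : sl false (lshift n i) z = z.2.1.1 i 0.
Proof. by rewrite /slack /slackQ split_lshift. Qed.

Lemma slackQ_r z j : sl false (rshift m j) z =
  z.2.2 - ((z.2.1.1^T *m C) 0 j + beta j 0 * z.2.1.2).
Proof. by rewrite /slack /slackQ split_rshift. Qed.

(** Along a recession direction the coordinates of [y] and of [x] are nonnegative with sum 0, so
    they vanish; only [pi1], [lambda] and [pi2] can move. *)
Lemma recession_shape s u : recc s u -> [/\ u.1.1 = 0, u.2.1.1 = 0,
  0 <= u.1.2, forall j, beta j 0 * u.2.1.2 <= u.2.2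
  & forall k, sl (s k) k u = 0].
Proof.
move=> [[hp hq su] ge].
have ge0 b k : 0 <= sl b k u.
  have [->|bs] := eqVneq b (s k); first by rewrite su.
  by have -> : b = ~~ s k by move: bs; case: b; case: (s k).
have y0 : u.1.1 = 0.
  apply/colP => j; rewrite mxE; move/eqP: hp; rewrite /massP psumr_eq0.
    by move=> /allP /(_ j (mem_index_enum _)) /eqP.
  by move=> j' _; rewrite -slackP_r.
have x0 : u.2.1.1 = 0.
  apply/colP => i; rewrite mxE; move/eqP: hq; rewrite /massQ psumr_eq0.
    by move=> /allP /(_ i (mem_index_enum _)) /eqP.
  by move=> i' _; rewrite -slackQ_l.
split=> //.
  (* [best js] merely supplies a row: with [y] zero every row inequality reads [0 <= pi1]. *)
  by have := ge0 true (lshift n (best js)); rewrite slackP_l y0 mulmx0 mxE subr0.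
move=> j; have := ge0 false (rshift m j).
by rewrite slackQ_r x0 trmx0 mul0mx mxE add0r subr_ge0.
Qed.

(** Both signs together force [pi2 = beta j * lambda] for every [j]; two different entries of [beta]
    then give [lambda = 0]. *)
Lemma recession_pointed s u : recc s u -> recc s (- u) -> u = 0.
Proof.
case: u => [[y p1] [[x l] p2]].
move=> /recession_shape[/= -> -> p1_ge bl _] /recession_shape[/= _ _ p1_le bl' _].
have p10 : p1 = 0 by lra.
have e j : p2 = beta j 0 * l by have := bl j; have := bl' j; rewrite mulrN; lra.
have l0 : l = 0.
  have := e js; rewrite (e jl); have := js_min (j := jl); rewrite eq_sym jsl => /(_ isT) lt.
  by move=> /eqP; rewrite -subr_eq0 -mulrBl mulf_eq0 subr_eq0 gt_eqF//= => /eqP.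
by rewrite p10 (e js) l0 mulr0.
Qed.

(** The choice at infinity, where [true] marks the inequality of [P]: [y] is the unit vector at [j0]
    and [x] the unit vector at the best row against it. *)
Definition ray_cell (j0 : 'I_n) : {ffun 'I_(m + n) -> bool} :=
  [ffun k => match fintype.split k with
             | inl i => i == best j0
             | inr j => j != j0
             end].

Lemma ray_cell_l j0 i : ray_cell j0 (lshift n i) = (i == best j0).
Proof. by rewrite ffunE split_lshift. Qed.

Lemma ray_cell_r j0 j : ray_cell j0 (rshift m j) = (j != j0).
Proof. by rewrite ffunE split_rshift. Qed.

(** A tight row is a maximum of column [j0], so row [best j0] is tight as well. If the two differed,
    they and the [n - 1] zero coordinates would be [n + 1] tight inequalities, one too many for
    [P]. *)
Lemma tight_at_unit (j0 : 'I_n) (v : Pspace R n) i : polyhedron hP gP v ->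
  (forall j, j != j0 -> v.1 j 0 = 0) -> gP (lshift n i) v = 0 -> i = best j0.
Proof.
move=> Kv v0 ti; have [hv gv] := Kv.
have vj0 : v.1 j0 0 = 1.
  by rewrite -hv /massP (bigD1 j0)//= big1 ?addr0// => j /v0.
have Av i' : (A *m v.1) i' 0 = A i' j0.
  by rewrite mxE (bigD1 j0)//= vj0 mulr1 big1 ?addr0// => j /v0 ->; rewrite mulr0.
have gl i' : gP (lshift n i') v = v.2 - A i' j0 by rewrite /slackP split_lshift Av.
have tb : gP (lshift n (best j0)) v = 0.
  have := gv (lshift n (best j0)); move: ti; rewrite !gl; have := best_max j0 i.
  by move=> *; lra.
apply: contrapT => /eqP ib.
have [+ _ _] := simpleP ndP Kv; apply/negP; rewrite -ltnNge.
pose S := lshift n i |: (lshift n (best j0) |: [set rshift m j | j in [set~ j0]])%SET.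
apply: (@leq_trans #|S|); last first.
  apply: subset_leq_card; apply/fintype.subsetP => k.
  rewrite !finset.in_setU1 inE => /orP[/eqP->|/orP[/eqP->|/imsetP[j]]].
  - by rewrite ti.
  - by rewrite tb.
  - by rewrite finset.in_setC1 => /v0 vj ->; rewrite /slackP split_rshift vj.
have nr (i' : 'I_m) : lshift n i' \notin [set rshift m j | j in [set~ j0]]%SET.
  by apply/imsetP => -[j _ /eqP]; rewrite eq_lrshift.
rewrite !finset.cardsU1 finset.in_setU1 negb_or !nr andbT.
rewrite (inj_eq (@lshift_inj _ _)) ib card_imset; last exact: rshift_inj.
rewrite cardsC1 card_ord !add1n.
by rewrite prednK// (leq_ltn_trans _ (ltn_ord j0)).
Qed.

Lemma recession_ray_cell s u : cl s !=set0 -> recc s u -> u != 0 ->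
  s = ray_cell js \/ s = ray_cell jl.
Proof.
move=> [z [[Kz1 Kz2] sz]] /recession_shape[y0 x0 p1_ge bl su] u0.
have [hz1 gz1] := Kz1; have [hz2 gz2] := Kz2.
(* Since [x] has mass 1, the choice cannot be [x_i = 0] for all rows; a row inequality of [P] kept
   tight along [u] gives [pi1 = 0]. Dually, the mass of [y] supplies [j0] below. *)
have p10 : u.1.2 = 0.
  have [[i si]|nex] := pselect (exists i, s (lshift n i)).
    by have := su (lshift n i); rewrite si slackP_l y0 mulmx0 mxE subr0.
  exfalso; move: hz2; rewrite /massQ big1 => [/eqP|i _]; first by rewrite eq_sym oner_eq0.
  have := sz (lshift n i).
  by case e: (s (lshift n i)); [case: nex; exists i|rewrite slackQ_l].
have Qtight j : s (rshift m j) = false -> u.2.2 = beta j 0 * u.2.1.2.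
  move=> sj; have := su (rshift m j); rewrite sj slackQ_r x0 trmx0 mul0mx mxE add0r.
  by move/eqP; rewrite subr_eq0 => /eqP.
have [j0 sj0] : exists j, s (rshift m j) = false.
  apply: contrapT => nex; move: hz1; rewrite /massP big1 => [/eqP|j _].
    by rewrite eq_sym oner_eq0.
  have := sz (rshift m j); case e: (s (rshift m j)); first by rewrite slackP_r.
  by case: nex; exists j.
have p2E := Qtight _ sj0.
have l0 : u.2.1.2 != 0.
  apply: contra u0 => /eqP l0; rewrite l0 mulr0 in p2E.
  by move: y0 x0 p10 l0 p2E; case: (u) => [[y p1] [[x l] p2]] /= -> -> -> -> ->.
suff rayE j1 : (forall j, s (rshift m j) = false -> j = j1) -> s = ray_cell j1.
  (* For negative [lambda] the strictest bound on [pi2] comes from the minimum entry of [beta], for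
     positive [lambda] from the maximum one; no other column can stay tight. *)
  move: l0; rewrite neq_lt => /orP[l_lt|l_gt]; [left|right]; apply: rayE => j /Qtight e.
    apply: contrapT => /eqP /js_min lt; have := bl js; rewrite e.
    by rewrite ler_nM2r// leNgt lt.
  apply: contrapT => /eqP /jl_max lt; have := bl jl; rewrite e.
  by rewrite ler_pM2r// leNgt lt.
move=> uniq; have j01 := uniq _ sj0; subst j1.
have sr j : s (rshift m j) = (j != j0).
  have [->//|jj] := eqVneq j j0; apply: contrapT => /negP /negbTE /uniq /eqP.
  by apply/negP.
have v0 j : j != j0 -> z.1.1 j 0 = 0.
  by move=> jj; have := sz (rshift m j); rewrite sr jj slackP_r.
have sl_best i : s (lshift n i) -> i = best j0.
  by move=> si; apply: (tight_at_unit Kz1 v0); have := sz (lshift n i); rewrite si.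
have [i si] : exists i, s (lshift n i).
  apply: contrapT => nex; move: hz2; rewrite /massQ big1 => [/eqP|i _].
    by rewrite eq_sym oner_eq0.
  have := sz (lshift n i); case e: (s (lshift n i)); last by rewrite slackQ_l.
  by case: nex; exists i.
apply/ffunP; apply: forall_label => [i'|j]; last by rewrite sr ray_cell_r.
rewrite ray_cell_l; apply/idP/eqP => [/sl_best//|->].
by rewrite -(sl_best i).
Qed.

(* The sign [s] selects the end [lambda -> +oo] or [lambda -> -oo]. *)
Lemma ray_cell_unbounded (s : R) (j0 : 'I_n) : s * s = 1 ->
  (forall j, j != j0 -> s * beta j 0 < s * beta j0 0) ->
  cl (ray_cell j0) !=set0 /\ exists2 u, u != 0 & recc (ray_cell j0) u.
Proof.
move=> ss smax; pose i0 := best j0.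
have s0 : s != 0 by apply/eqP => s0; move/eqP: ss; rewrite s0 mul0r eq_sym oner_eq0.
pose y : 'cV[R]_n := delta_mx j0 0.
pose x : 'cV[R]_m := delta_mx i0 0.
have Ay i : (A *m y) i 0 = A i j0 by rewrite -colE mxE.
have xC j : (x^T *m C) 0 j = C i0 j by rewrite trmx_delta -rowE mxE.
have y_sum : \sum_j y j 0 = 1.
  rewrite (bigD1 j0)//= mxE !eqxx big1 ?addr0// => j jj.
  by rewrite mxE (negbTE jj).
have x_sum : \sum_i x i 0 = 1.
  rewrite (bigD1 i0)//= mxE !eqxx big1 ?addr0// => j jj.
  by rewrite mxE (negbTE jj).
(* Each term is a size of [lambda] that suffices for column [j0] to be at least as good as column
   [j]; the sum dominates all of these nonnegative terms, and the term at [j0] is 0. *)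
pose t := \sum_j `|C i0 j - C i0 j0| / (s * beta j0 0 - s * beta j 0).
have term_ge j : 0 <= `|C i0 j - C i0 j0| / (s * beta j0 0 - s * beta j 0).
  rewrite divr_ge0//; have [->|/smax] := eqVneq j j0; last lra.
  by rewrite subrr.
have t_ge j : j != j0 ->
    C i0 j + beta j 0 * (s * t) <= C i0 j0 + beta j0 0 * (s * t).
  move=> jj; have lt := smax _ jj.
  have : `|C i0 j - C i0 j0| / (s * beta j0 0 - s * beta j 0) <= t.
    by rewrite /t (bigD1 j)//= lerDl sumr_ge0.
  rewrite ler_pdivrMr ?subr_gt0// => ht.
  have := ler_norm (C i0 j - C i0 j0); nra.
pose z : Pspace R n * Qspace R m :=
  ((y, A i0 j0), ((x, s * t), C i0 j0 + beta j0 0 * (s * t))).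
have zl i : sl true (lshift n i) z = A i0 j0 - A i j0 by rewrite slackP_l Ay.
have zr j : sl true (rshift m j) z = (j == j0)%:R by rewrite slackP_r mxE eqxx andbT.
have wl i : sl false (lshift n i) z = (i == i0)%:R by rewrite slackQ_l mxE eqxx andbT.
have wr j : sl false (rshift m j) z =
    C i0 j0 + beta j0 0 * (s * t) - (C i0 j + beta j 0 * (s * t)).
  by rewrite slackQ_r xC.
split.
  exists z; split; [split; split=> //|].
  - apply: forall_label => [i|j]; rewrite -/(sl true _ z).
      by rewrite zl subr_ge0; exact: best_max.
    by rewrite zr; exact: ler0n.
  - apply: forall_label => [i|j]; rewrite -/(sl false _ z).
      by rewrite wl; exact: ler0n.
    rewrite wr subr_ge0; have [->//|] := eqVneq j j0; exact: t_ge.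
  - apply: forall_label => [i|j]; rewrite ?ray_cell_l ?ray_cell_r.
      have [->|ii] := eqVneq i (best j0); first by rewrite zl subrr.
      by rewrite wl (negbTE ii).
    have [->|jj] := eqVneq j j0; first by rewrite wr subrr.
    by rewrite zr (negbTE jj).
pose u : Pspace R n * Qspace R m := ((0, 0), ((0, s), s * beta j0 0)).
have ul i : sl true (lshift n i) u = 0 by rewrite slackP_l mulmx0 mxE subrr.
have ur j : sl true (rshift m j) u = 0 by rewrite slackP_r mxE.
have vl i : sl false (lshift n i) u = 0 by rewrite slackQ_l mxE.
have vr j : sl false (rshift m j) u = s * beta j0 0 - s * beta j 0.
  by rewrite slackQ_r trmx0 mul0mx mxE add0r [beta j 0 * _]mulrC.
exists u; first by apply: contra s0 => /eqP[->].
split; [split|].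
- by rewrite /massP big1// => j _; rewrite mxE.
- by rewrite /massQ big1// => j _; rewrite mxE.
- apply: forall_label => [i|j]; rewrite ?ray_cell_l ?ray_cell_r.
    by case: eqP => _; rewrite ?ul ?vl.
  by have [->|jj] := eqVneq j j0; rewrite ?ur// vr subrr.
- apply: forall_label => [i|j]; rewrite ?ray_cell_l ?ray_cell_r.
    by case: eqP => _; rewrite ?ul ?vl.
  have [->|jj] := eqVneq j j0; first by rewrite ur.
  by rewrite vr subr_ge0 ltW// smax.
Qed.

End Rays.

Theorem proposition4 (R : realType) (m n : nat) (A C : 'M[R]_(m, n))
    (beta : 'cV[R]_n)
    (hA : A != 0) (hC : C != 0) (hbeta : beta != 0)
    (hP : nondegenerateP A) (hQ : nondegenerateQ C beta) :
  exists (Pth : set (Pspace R n * Qspace R m)%type) (k : nat)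
         (Cyc : 'I_k -> set (Pspace R n * Qspace R m)%type),
    fully_labeled A C beta = Pth `|` \bigcup_i Cyc i /\
    (forall i, Pth `&` Cyc i = set0) /\
    (forall i j, i != j -> Cyc i `&` Cyc j = set0) /\
    is_component (fully_labeled A C beta) Pth /\
    (forall i, is_component (fully_labeled A C beta) (Cyc i)) /\
    is_path (polyhedronP A `*` polyhedronQ C beta) Pth /\
    (forall i, is_cycle (polyhedronP A `*` polyhedronQ C beta) (Cyc i)).
Proof.
have [ndQ [js [jl [js_min jl_max jsl]]]] := hQ.
have [best best_max] : exists best : 'I_n -> 'I_m,
    forall j i, A i j <= A (best j) j.
  (* A row exists, since a matrix without rows is zero. *)
  have [i0 _] : exists i0 : 'I_m, True.
    apply: contrapT => none; move/negP: hA; apply; apply/eqP/matrixP => i.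
    by case: none; exists i.
  have maxA j : exists i', forall i, A i j <= A i' j.
    have [i _ imax] := Order.TotalTheory.arg_maxP (fun i => A i j) (isT : predT i0).
    by exists i => i'; exact: imax.
  by exists (fun j => projT1 (cid (maxA j))) => j; exact: projT2 (cid (maxA j)).
have -> : fully_labeled A C beta =
    [set z | (polyhedron (@massP R n) (slackP A) `*`
              polyhedron (@massQ R m) (slackQ C beta)) z /\
      forall k, slack (slackP A) (slackQ C beta) true k z = 0 \/
                slack (slackP A) (slackQ C beta) false k z = 0].
  rewrite /fully_labeled polyhedronPE polyhedronQE labelPE labelQE.
  apply/seteqP; split=> [z [Kv Kw /setP lab]|z [[Kv Kw] lab]]; split=> //.
    move=> k; have := lab k; rewrite !inE => /orP[]/eqP; [by left|by right].
  by apply/setP => k; rewrite !inE; case: (lab k) => [e|e]; apply/orP; [left|right]; apply/eqP.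
rewrite polyhedronPE polyhedronQE.
have N11 : -1 * -1 = 1 :> R by rewrite mulrNN mulr1.
have [|cs rs] := @ray_cell_unbounded R m n A C beta best best_max (-1) js N11.
  by move=> j /js_min; rewrite !mulN1r ltrN2.
have [|cl rl] := @ray_cell_unbounded R m n A C beta best best_max 1 jl (mulr1 1).
  by move=> j /jl_max; rewrite !mul1r.
apply: (product_decomposition (@linear_massP R n) (@linear_massQ R m)
  (linear_slackP A) (linear_slackQ C beta) (@massP_continuous R n)
  (@massQ_continuous R m) (@slackP_continuous R m n A)
  (@slackQ_continuous R m n C beta) (simpleP hP) (simpleQ ndQ) _ _ _ cs cl rs rl).
(* The two dimensions [n] and [m + 1] exceed the number of labels by exactly one. *)
- by rewrite addnS addnC.
- exact: recession_pointed js_min jsl best.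
- apply/eqP => /ffunP /(_ (rshift m jl)); rewrite !ray_cell_r eqxx eq_sym.
  by rewrite jsl.
- exact: (recession_ray_cell (best := best) hP js_min jl_max best_max).
Qed.
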